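(* Consider equations of the form $$u_t+uu_x+\alpha(t)u+\beta(t)u_{xxxxx}=0,\qquad \beta\neq0,$$ where $\alpha$ and $\beta$ are smooth functions of $t$. A variable coefficient equation of this form is reducible (by a point transformation) to a constant coefficient fifth-order KdV equation $$u_t+uu_x+\mu u_{xxxxx}=0,\qquad \mu=\mathrm{const},$$ if and only if its coefficients $\alpha$ and $\beta$ are related by the formula $$\beta=e^{-\int\alpha(t)\,dt}\left(c_1\int e^{-\int\alpha(t)\,dt}\,dt+c_2\right)^3,$$ where $c_1$ and $c_2$ are arbitrary constants with $(c_1,c_2)\neq(0,0)$.
   Context: All considerations are local, with real-valued smooth functions, and $t$ ranges over an interval on which $\beta$ does not vanish. The integrals denote a fixed choice of antiderivatives. ''Reducible'' means that there is a nondegenerate point transformation (local diffeomorphism) $(t,x,u)\mapsto(\tilde t,\tilde x,\tilde u)$ mapping the given equation to an equation of the indicated constant coefficient form with some nonzero constant $\mu$. *)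

(* Defs.v *)
From Stdlib Require Import Reals.
From Coquelicot Require Import Coquelicot.
Open Scope R_scope.

Definition in_itv (a b : Rbar) (t : R) : Prop := Rbar_lt a t /\ Rbar_lt t b.

Definition smooth_on_itv (a b : Rbar) (f : R -> R) : Prop :=
  forall t, in_itv a b t -> forall n, ex_derive_n f n t.

(* [ex_diff_n] only speaks about one point; required throughout a neighbourhood
   it says that all partial derivatives exist and are continuous there. *)
Definition smooth2_near (f : R -> R -> R) (t x : R) : Prop :=
  locally_2d (fun s y => forall n, ex_diff_n f n s y) t x.

Definition Dt (F : R -> R -> R -> R) (t x u : R) : R := Derive (fun s => F s x u) t.
Definition Dx (F : R -> R -> R -> R) (t x u : R) : R := Derive (fun y => F t y u) x.
Definition Du (F : R -> R -> R -> R) (t x u : R) : R := Derive (fun v => F t x v) u.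

(* Three-variable analogue of Coquelicot's [ex_diff_n]. *)
Fixpoint ex_diff3_n (F : R -> R -> R -> R) (n : nat) (t x u : R) : Prop :=
  continuous (fun p : R * R * R => F (fst (fst p)) (snd (fst p)) (snd p)) (t, x, u) /\
  match n with
  | O => True
  | S m =>
      ex_derive (fun s => F s x u) t /\
      ex_derive (fun y => F t y u) x /\
      ex_derive (fun v => F t x v) u /\
      ex_diff3_n (Dt F) m t x u /\
      ex_diff3_n (Dx F) m t x u /\
      ex_diff3_n (Du F) m t x u
  end.

Definition open3 (Om : R -> R -> R -> Prop) : Prop :=
  open (fun p : R * R * R => Om (fst (fst p)) (snd (fst p)) (snd p)).

Definition smooth3_on (Om : R -> R -> R -> Prop) (F : R -> R -> R -> R) : Prop :=
  forall t x u, Om t x u -> forall n, ex_diff3_n F n t x u.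

Definition jacobian (T X U : R -> R -> R -> R) (t x u : R) : R :=
    Dt T t x u * (Dx X t x u * Du U t x u - Du X t x u * Dx U t x u)
  - Dx T t x u * (Dt X t x u * Du U t x u - Du X t x u * Dt U t x u)
  + Du T t x u * (Dt X t x u * Dx U t x u - Dx X t x u * Dt U t x u).

Definition point_transformation
    (Om : R -> R -> R -> Prop) (T X U : R -> R -> R -> R) : Prop :=
  open3 Om /\ smooth3_on Om T /\ smooth3_on Om X /\ smooth3_on Om U /\
  forall t x u, Om t x u -> jacobian T X U t x u <> 0.

(* Near (t0, x0) the transformation carries the graph of [f] into that of [g]. *)
Definition carries_graph (T X U : R -> R -> R -> R) (f g : R -> R -> R) (t0 x0 : R) : Prop :=
  locally_2d
    (fun t x => g (T t x (f t x)) (X t x (f t x)) = U t x (f t x)) t0 x0.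

(* A differential equation is given by its validity for a function at a point,
   i.e. by a subset of the jet space.  The jet of [g] at the image point is the
   image of the jet of [f] under the prolonged transformation, so the condition
   says that the prolongation maps jets on [E] to jets on [E'] and jets off [E]
   to jets off [E'].  No separate transversality assumption is needed: by
   nondegeneracy, if both graphs are graphs of functions then
   (t, x) |-> (T, X)(t, x, f t x) is a local diffeomorphism at (t0, x0). *)
Definition maps_equation
    (Om : R -> R -> R -> Prop) (T X U : R -> R -> R -> R)
    (E E' : (R -> R -> R) -> R -> R -> Prop) : Prop :=
  forall (f g : R -> R -> R) (t0 x0 : R),
    let u0 := f t0 x0 in
    let t1 := T t0 x0 u0 in
    let x1 := X t0 x0 u0 in
    Om t0 x0 u0 ->
    smooth2_near f t0 x0 ->
    smooth2_near g t1 x1 ->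
    carries_graph T X U f g t0 x0 ->
    (E f t0 x0 <-> E' g t1 x1).

Definition vc_kdv5 (alpha beta : R -> R) (u : R -> R -> R) (t x : R) : Prop :=
  Derive (fun s => u s x) t + u t x * Derive (fun y => u t y) x
  + alpha t * u t x + beta t * Derive_n (fun y => u t y) 5 x = 0.

Definition cc_kdv5 (mu : R) (u : R -> R -> R) (t x : R) : Prop :=
  Derive (fun s => u s x) t + u t x * Derive (fun y => u t y) x
  + mu * Derive_n (fun y => u t y) 5 x = 0.

(* The transformation need only be defined on an open set of (t, x, u), but
   over every t of the interval (a, b) on which the equation is considered. *)
Definition reducible (a b : Rbar) (alpha beta : R -> R) : Prop :=
  exists (mu : R) (Om : R -> R -> R -> Prop) (T X U : R -> R -> R -> R),
    mu <> 0 /\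
    (forall t x u, Om t x u -> in_itv a b t) /\
    (forall t, in_itv a b t -> exists x u, Om t x u) /\
    point_transformation Om T X U /\
    maps_equation Om T X U (vc_kdv5 alpha beta) (cc_kdv5 mu).

(* Main.v *)
From Stdlib Require Import Reals Lra Lia Ranalysis5 Classical ClassicalEpsilon.
From Coquelicot Require Import Coquelicot.
Require Import Defs.
Open Scope R_scope.

(** Necessity.  Through every point (t0, x0, u0) of the domain we prescribe the image
    solution to be an explicit polynomial g whose jet satisfies the target equation; the
    implicit function theorem applied to g (T, X) = U yields the preimage f, so the jet of f
    satisfies the source equation.  Comparing two choices of g isolates one coefficient of
    the transformation at a time, with no formula for the fifth prolongation:
    - adding (tau - t1)^5 to g changes only the fifth x-derivative of f, by a multiple of
      (D_x T)^5; hence T_x = T_u = 0;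
    - trading g_t against (xi - x1)^5 gives beta (D_x X)^5 = mu T_t for all slopes of f;
      hence X_u = 0 and X is affine in x;
    - adding (xi - x1)^4 forces U_u to be a function of t only;
    - varying the slope of g gives T_t U = X_t + u X_x and U_t + u U_x = alpha u U_u.
    With a = X_x, S = T_t, k = U_x, th = U_u, functions of t, this says a' = S k, S th = a,
    k' = 0, th' = alpha th - k and beta a^5 = mu S.  Then C = a th exp (-A) is constant,
    1 / a + (k / C) B is constant, and beta = (mu / C) exp (-A) / a^3.  The constants found near
    each t agree on the whole interval, since the cube root w of beta exp A determines them by
    c1 = w' exp A and c2 = w - c1 B.

    Sufficiency.  With w = c1 B + c2, the transformation X = x / w, U = w exp (A) u - c1 x,
    T' = exp (-A) / w^2 leads to mu = 1. *)

(** * Smooth functions of three variables *)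

(** [maps_equation] is stated with functions rather than jets, so all information on [T], [X], [U]
    has to come from actual pairs of functions with corresponding graphs. The image is the
    convenient one to prescribe: at a single point a polynomial satisfies the target equation as
    soon as one linear condition on its coefficients holds. The price is that the preimage is only
    an implicit function, whose fifth derivative has no manageable expression. What is accessible is
    the difference of two preimages: the mean value theorem in [u] writes it as a polynomial in the
    increments of [T] and [X] divided by a nonvanishing factor, and uniqueness of Taylor expansions
    then yields its fifth derivative. Mean value points need not vary continuously; here they are
    squeezed between two preimages of equal slope, which makes them differentiable at the base
    point.

    The transformation used for sufficiency solves the same structure equations with [a = 1 / w] and
    [C = mu = 1]: then [S = exp (- A) / w^2], [th = w * exp A], [k = - c1]. *)

Definition uncurry3 (F : R -> R -> R -> R) (p : R * R * R) : R :=
  F (fst (fst p)) (snd (fst p)) (snd p).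

(** The order is a parameter because the closure properties go by induction on it, with the partial
    derivatives as new functions; the set is a parameter because the rules for computing these
    derivatives hold only on it. *)
Definition smooth3_n (Om : R -> R -> R -> Prop) (n : nat) (F : R -> R -> R -> R) : Prop :=
  forall t x u, Om t x u -> ex_diff3_n F n t x u.

(** The ball of the product uniform structure on [R * R * R], spelled out as inequalities. *)
Definition box (e t0 x0 u0 t x u : R) : Prop :=
  Rabs (t - t0) < e /\ Rabs (x - x0) < e /\ Rabs (u - u0) < e.

Lemma locally_box (P : R * R * R -> Prop) (t0 x0 u0 : R) :
  locally (t0, x0, u0) P <->
  exists e : posreal, forall t x u, box e t0 x0 u0 t x u -> P (t, x, u).
Proof.
  split; intros [e He]; exists e.
  - intros t x u (H1 & H2 & H3); apply He; repeat split; assumption.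
  - intros [[t x] u] [[H1 H2] H3]; apply He; repeat split; assumption.
Qed.

Lemma open3_box (Om : R -> R -> R -> Prop) (t0 x0 u0 : R) :
  open3 Om -> Om t0 x0 u0 ->
  exists e : posreal, forall t x u, box e t0 x0 u0 t x u -> Om t x u.
Proof.
  intros HO H; exact (proj1 (locally_box _ t0 x0 u0) (HO (t0, x0, u0) H)).
Qed.

Lemma open3_slices (Om : R -> R -> R -> Prop) (t x u : R) :
  open3 Om -> Om t x u ->
  locally t (fun s => Om s x u) /\ locally x (fun y => Om t y u) /\ locally u (fun v => Om t x v).
Proof.
  intros HO H; destruct (open3_box Om t x u HO H) as [e He].
  pose proof (cond_pos e) as Hp.
  split; [|split]; exists e; intros y Hy; apply He; unfold box;
    rewrite ?Rminus_diag, ?Rabs_R0; repeat split; try exact Hp; exact Hy.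
Qed.

(** Openness of [Om] makes the slices of [F] and [G] agree near each point, hence also their
    derivatives. In the inductions below this replaces [Dt], [Dx], [Du] of a sum, product or inverse
    by the computed expression, which is valid only on [Om]. *)
Lemma smooth3_n_ext (Om : R -> R -> R -> Prop) (HO : open3 Om) (n : nat) :
  forall F G : R -> R -> R -> R,
  (forall t x u, Om t x u -> F t x u = G t x u) ->
  smooth3_n Om n F -> smooth3_n Om n G.
Proof.
  induction n as [|n IH]; intros F G HFG HF t x u H;
    pose proof (HF t x u H) as HFp; simpl in HFp |- *; destruct HFp as [Hc HFp].
  - split; [|exact I].
    apply (continuous_ext_loc _ (uncurry3 F)); [|exact Hc].
    apply (filter_imp (fun p : R * R * R => Om (fst (fst p)) (snd (fst p)) (snd p)));
      [|exact (HO (t, x, u) H)].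
    intros [[s y] v]; unfold uncurry3; simpl; apply HFG.
  - assert (Hloc : forall t x u, Om t x u ->
      locally t (fun s => F s x u = G s x u) /\
      locally x (fun y => F t y u = G t y u) /\
      locally u (fun v => F t x v = G t x v)).
    { intros t' x' u' H'; destruct (open3_slices Om t' x' u' HO H') as (L1 & L2 & L3).
      split; [|split]; [revert L1|revert L2|revert L3]; apply filter_imp; intros; now apply HFG. }
    destruct HFp as (H1 & H2 & H3 & H4 & H5 & H6).
    destruct (Hloc t x u H) as (L1 & L2 & L3).
    split; [|split; [|split; [|split; [|split; [|split]]]]].
    + apply (continuous_ext_loc _ (uncurry3 F)); [|exact Hc].
      apply (filter_imp (fun p : R * R * R => Om (fst (fst p)) (snd (fst p)) (snd p)));
        [|exact (HO (t, x, u) H)].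
      intros [[s y] v]; unfold uncurry3; simpl; apply HFG.
    + now apply (ex_derive_ext_loc (fun s => F s x u)).
    + now apply (ex_derive_ext_loc (fun y => F t y u)).
    + now apply (ex_derive_ext_loc (fun v => F t x v)).
    + apply (IH (Dt F)); [|intros a b c K; apply (HF a b c K)|exact H].
      intros a b c K; apply Derive_ext_loc; apply Hloc; exact K.
    + apply (IH (Dx F)); [|intros a b c K; apply (HF a b c K)|exact H].
      intros a b c K; apply Derive_ext_loc; apply Hloc; exact K.
    + apply (IH (Du F)); [|intros a b c K; apply (HF a b c K)|exact H].
      intros a b c K; apply Derive_ext_loc; apply Hloc; exact K.
Qed.

Lemma smooth3_n_S (Om : R -> R -> R -> Prop) (n : nat) (F : R -> R -> R -> R) :
  smooth3_n Om (S n) F <->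
  (forall t x u, Om t x u -> continuous (uncurry3 F) (t, x, u)) /\
  (forall t x u, Om t x u -> ex_derive (fun s => F s x u) t /\
     ex_derive (fun y => F t y u) x /\ ex_derive (fun v => F t x v) u) /\
  smooth3_n Om n (Dt F) /\ smooth3_n Om n (Dx F) /\ smooth3_n Om n (Du F).
Proof.
  split.
  - intros H; repeat split; try (intros t x u K; apply (H t x u K));
      try apply (H t x u H0).
  - intros (H1 & H2 & H3 & H4 & H5) t x u K.
    destruct (H2 t x u K) as (K1 & K2 & K3).
    split; [exact (H1 t x u K)|]; auto 10.
Qed.

Lemma smooth3_n_cont (Om : R -> R -> R -> Prop) (n : nat) (F : R -> R -> R -> R) (t x u : R) :
  smooth3_n Om n F -> Om t x u -> continuous (uncurry3 F) (t, x, u).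
Proof. intros H K; specialize (H t x u K); destruct n; apply H. Qed.

Lemma smooth3_n_0 (Om : R -> R -> R -> Prop) (F : R -> R -> R -> R) :
  (forall t x u, Om t x u -> continuous (uncurry3 F) (t, x, u)) -> smooth3_n Om 0 F.
Proof. intros H t x u K; split; [exact (H t x u K)|exact I]. Qed.

Lemma smooth3_n_pred (Om : R -> R -> R -> Prop) (n : nat) :
  forall F, smooth3_n Om (S n) F -> smooth3_n Om n F.
Proof.
  induction n as [|n IH]; intros F H.
  - apply smooth3_n_0; intros t x u K; now apply (smooth3_n_cont Om 1).
  - apply smooth3_n_S in H; destruct H as (H1 & H2 & H3 & H4 & H5).
    apply smooth3_n_S; auto 10.
Qed.

Lemma smooth3_n_const (Om : R -> R -> R -> Prop) (n : nat) :
  forall c, smooth3_n Om n (fun _ _ _ => c).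
Proof.
  induction n as [|n IH]; intros c.
  - apply smooth3_n_0; intros; apply continuous_const.
  - apply smooth3_n_S; split; [intros; apply continuous_const|].
    split; [intros; repeat split; apply ex_derive_const|].
    repeat split; intros t x u K;
    match goal with |- ex_diff3_n ?G _ _ _ _ =>
      replace G with (fun _ _ _ : R => 0); [now apply (IH 0)|] end;
      repeat (apply FunctionalExtensionality.functional_extensionality; intro);
      unfold Dt, Dx, Du; now rewrite Derive_const.
Qed.

(** * Closure of finite-order differentiability under arithmetic operations *)

Section Calculus.
Variable Om : R -> R -> R -> Prop.
Hypothesis HO : open3 Om.

Lemma smooth3_n_plus (n : nat) :
  forall F G, smooth3_n Om n F -> smooth3_n Om n G ->
  smooth3_n Om n (fun t x u => F t x u + G t x u).
Proof.
  induction n as [|n IH]; intros F G HF HG.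
  - apply smooth3_n_0; intros t x u K.
    apply (continuous_plus (uncurry3 F) (uncurry3 G)); (apply (smooth3_n_cont Om 0); assumption).
  - pose proof (fun t x u => smooth3_n_cont _ _ _ t x u HF) as CF.
    pose proof (fun t x u => smooth3_n_cont _ _ _ t x u HG) as CG.
    apply smooth3_n_S in HF; destruct HF as (F1 & F2 & F3 & F4 & F5).
    apply smooth3_n_S in HG; destruct HG as (G1 & G2 & G3 & G4 & G5).
    apply smooth3_n_S; split; [|split; [|split; [|split]]].
    + intros t x u K; apply (continuous_plus (uncurry3 F) (uncurry3 G)); auto.
    + intros t x u K; destruct (F2 t x u K) as (? & ? & ?), (G2 t x u K) as (? & ? & ?).
      split; [|split].
      * now apply (ex_derive_plus (fun s => F s x u) (fun s => G s x u)).
      * now apply (ex_derive_plus (fun s => F t s u) (fun s => G t s u)).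
      * now apply (ex_derive_plus (fun s => F t x s) (fun s => G t x s)).
    + apply (smooth3_n_ext Om HO n (fun t x u => Dt F t x u + Dt G t x u)); [|now apply IH].
      intros t x u K; symmetry; unfold Dt, Dx, Du;
      destruct (F2 t x u K) as (? & ? & ?), (G2 t x u K) as (? & ? & ?).
      now apply (Derive_plus (fun s => F s x u) (fun s => G s x u)).
    + apply (smooth3_n_ext Om HO n (fun t x u => Dx F t x u + Dx G t x u)); [|now apply IH].
      intros t x u K; symmetry; unfold Dt, Dx, Du;
      destruct (F2 t x u K) as (? & ? & ?), (G2 t x u K) as (? & ? & ?).
      now apply (Derive_plus (fun s => F t s u) (fun s => G t s u)).
    + apply (smooth3_n_ext Om HO n (fun t x u => Du F t x u + Du G t x u)); [|now apply IH].
      intros t x u K; symmetry; unfold Dt, Dx, Du;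
      destruct (F2 t x u K) as (? & ? & ?), (G2 t x u K) as (? & ? & ?).
      now apply (Derive_plus (fun s => F t x s) (fun s => G t x s)).
Qed.

Lemma smooth3_n_mult (n : nat) :
  forall F G, smooth3_n Om n F -> smooth3_n Om n G ->
  smooth3_n Om n (fun t x u => F t x u * G t x u).
Proof.
  induction n as [|n IH]; intros F G HF HG.
  - apply smooth3_n_0; intros t x u K.
    apply (continuous_mult (uncurry3 F) (uncurry3 G)); (apply (smooth3_n_cont Om 0); assumption).
  - pose proof (smooth3_n_pred _ _ _ HF) as PF.
    pose proof (smooth3_n_pred _ _ _ HG) as PG.
    apply smooth3_n_S in HF; destruct HF as (F1 & F2 & F3 & F4 & F5).
    apply smooth3_n_S in HG; destruct HG as (G1 & G2 & G3 & G4 & G5).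
    apply smooth3_n_S; split; [|split; [|split; [|split]]].
    + intros t x u K; apply (continuous_mult (uncurry3 F) (uncurry3 G)); auto.
    + intros t x u K; destruct (F2 t x u K) as (? & ? & ?), (G2 t x u K) as (? & ? & ?).
      split; [|split].
      * now apply (ex_derive_mult (fun s => F s x u) (fun s => G s x u)).
      * now apply (ex_derive_mult (fun s => F t s u) (fun s => G t s u)).
      * now apply (ex_derive_mult (fun s => F t x s) (fun s => G t x s)).
    + apply (smooth3_n_ext Om HO n (fun t x u => Dt F t x u * G t x u + F t x u * Dt G t x u)).
      * intros t x u K; symmetry; unfold Dt, Dx, Du;
      destruct (F2 t x u K) as (? & ? & ?), (G2 t x u K) as (? & ? & ?).
        now apply (Derive_mult (fun s => F s x u) (fun s => G s x u)).
      * apply smooth3_n_plus; now apply IH.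
    + apply (smooth3_n_ext Om HO n (fun t x u => Dx F t x u * G t x u + F t x u * Dx G t x u)).
      * intros t x u K; symmetry; unfold Dt, Dx, Du;
      destruct (F2 t x u K) as (? & ? & ?), (G2 t x u K) as (? & ? & ?).
        now apply (Derive_mult (fun s => F t s u) (fun s => G t s u)).
      * apply smooth3_n_plus; now apply IH.
    + apply (smooth3_n_ext Om HO n (fun t x u => Du F t x u * G t x u + F t x u * Du G t x u)).
      * intros t x u K; symmetry; unfold Dt, Dx, Du;
      destruct (F2 t x u K) as (? & ? & ?), (G2 t x u K) as (? & ? & ?).
        now apply (Derive_mult (fun s => F t x s) (fun s => G t x s)).
      * apply smooth3_n_plus; now apply IH.
Qed.

(** The derivatives of [/ F] are derivatives of [F] times [-1 * (/ F * / F)], so order [n] of [/ F]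
    itself gives order [n + 1]. *)
Lemma smooth3_n_inv (n : nat) :
  forall F, (forall t x u, Om t x u -> F t x u <> 0) -> smooth3_n Om n F ->
  smooth3_n Om n (fun t x u => / F t x u).
Proof.
  intros F HF0; induction n as [|n IH]; intros HF.
  - apply smooth3_n_0; intros t x u K.
    apply (continuous_comp (uncurry3 F) Rinv).
    + (apply (smooth3_n_cont Om 0); assumption).
    + apply continuous_Rinv, HF0, K.
  - pose proof (IH (smooth3_n_pred _ _ _ HF)) as IF.
    apply smooth3_n_S in HF; destruct HF as (F1 & F2 & F3 & F4 & F5).
    assert (Hsm : forall G, smooth3_n Om n G ->
      smooth3_n Om n (fun t x u => G t x u * (-1 * (/ F t x u * / F t x u)))).
    { intros G HG; apply smooth3_n_mult; [exact HG|].
      apply (smooth3_n_mult n (fun _ _ _ => -1)); [apply smooth3_n_const|].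
      now apply smooth3_n_mult. }
    apply smooth3_n_S; split; [|split; [|split; [|split]]].
    + intros t x u K; apply (continuous_comp (uncurry3 F) Rinv);
        [apply F1, K|apply continuous_Rinv, HF0, K].
    + intros t x u K; destruct (F2 t x u K) as (? & ? & ?).
      split; [|split].
      * apply (ex_derive_inv (fun s => F s x u)); auto.
      * apply (ex_derive_inv (fun s => F t s u)); auto.
      * apply (ex_derive_inv (fun s => F t x s)); auto.
    + apply (smooth3_n_ext Om HO n _ _) with (2 := Hsm _ F3).
      intros t x u K; symmetry; unfold Dt; pose proof (HF0 t x u K);
      destruct (F2 t x u K) as (? & ? & ?).
      rewrite (Derive_inv (fun s => F s x u)); [now field|assumption|assumption].
    + apply (smooth3_n_ext Om HO n _ _) with (2 := Hsm _ F4).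
      intros t x u K; symmetry; unfold Dx; pose proof (HF0 t x u K);
      destruct (F2 t x u K) as (? & ? & ?).
      rewrite (Derive_inv (fun s => F t s u)); [now field|assumption|assumption].
    + apply (smooth3_n_ext Om HO n _ _) with (2 := Hsm _ F5).
      intros t x u K; symmetry; unfold Du; pose proof (HF0 t x u K);
      destruct (F2 t x u K) as (? & ? & ?).
      rewrite (Derive_inv (fun s => F t x s)); [now field|assumption|assumption].
Qed.

End Calculus.

(** * Chain rule and implicit functions *)

Lemma continuous3_eps (G : R -> R -> R -> R) (t x u : R) :
  continuous (uncurry3 G) (t, x, u) ->
  forall eps : posreal, exists d : posreal, forall t' x' u',
    box d t x u t' x' u' -> Rabs (G t' x' u' - G t x u) < eps.
Proof.
  intros H eps.
  pose proof (proj1 (filterlim_locally _ _) H eps) as L.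
  apply locally_box in L; destruct L as [d Hd]; exists d; intros t' x' u' B.
  exact (Hd t' x' u' B).
Qed.

Lemma continuous3_slices (G : R -> R -> R -> R) (t x u : R) :
  continuous (uncurry3 G) (t, x, u) ->
  continuity_2d_pt (fun s v => G s x v) t u /\ continuity_2d_pt (fun y v => G t y v) x u /\
  continuity_2d_pt (fun s y => G s y u) t x.
Proof.
  intros H; repeat split; intros eps; destruct (continuous3_eps G t x u H eps) as [d Hd];
    exists d; intros p q Hp Hq; apply Hd; unfold box; rewrite ?Rminus_diag, ?Rabs_R0;
    repeat split; try assumption; apply cond_pos.
Qed.

(** One partial derivative exists nearby and is continuous at the point; for the other, existence at
    the point is enough to get joint differentiability. *)
Lemma differentiable_of_C1 (F : R -> R -> R) (s u : R) :
  locally_2d (fun s v => ex_derive (fun z => F z v) s) s u ->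
  ex_derive (fun v => F s v) u ->
  continuity_2d_pt (fun s v => Derive (fun z => F z v) s) s u ->
  differentiable_pt_lim F s u (Derive (fun z => F z u) s) (Derive (fun v => F s v) u).
Proof.
  intros H1 H2 H3; apply filterdiff_differentiable_pt_lim.
  apply (is_derive_filterdiff F s u (fun s v => Derive (fun z => F z v) s)).
  - apply locally_2d_locally in H1; revert H1; apply filter_imp; intros [p q] K.
    now apply Derive_correct.
  - now apply Derive_correct.
  - now apply continuity_2d_pt_filterlim in H3.
Qed.

Lemma is_derive_comp_2d (F : R -> R -> R) (phi psi : R -> R) (s l1 l2 d1 d2 : R) :
  differentiable_pt_lim F (phi s) (psi s) l1 l2 ->
  is_derive phi s d1 -> is_derive psi s d2 ->
  is_derive (fun s => F (phi s) (psi s)) s (l1 * d1 + l2 * d2).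
Proof.
  intros H H1 H2; apply is_derive_Reals; apply is_derive_Reals in H1, H2.
  now apply derivable_pt_lim_comp_2d.
Qed.

(** With [D] the increment of [phi], differentiability gives [l1 * h + l2 * D = o(|h| + |D|)]. A
    first use bounds [|D|] by [M * |h|]; the error is then [o(|h|)], and division by [l2 * h] gives
    the derivative. *)
Lemma implicit_is_derive (F : R -> R -> R) (phi : R -> R) (s l1 l2 : R) :
  differentiable_pt_lim F s (phi s) l1 l2 -> l2 <> 0 ->
  continuous phi s -> locally s (fun z => F z (phi z) = 0) ->
  is_derive phi s (- (l1 / l2)).
Proof.
  intros HF Hl2 Hc H0.
  assert (Hl : 0 < Rabs l2) by now apply Rabs_pos_lt.
  set (M := 2 * (Rabs l1 + Rabs l2 / 2) / Rabs l2).
  assert (HM : 0 <= M).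
  { unfold M; apply Rmult_le_pos; [pose proof (Rabs_pos l1); lra|].
    now apply Rlt_le, Rinv_0_lt_compat. }
  apply is_derive_Reals; intros eps He.
  (* The first bound lets [l2 * D] absorb the error, which yields the Lipschitz constant [M]; the
     second brings the final error below [eps / 2]. *)
  set (e := Rmin (Rabs l2 / 2) (eps / 2 * Rabs l2 / (1 + M))).
  assert (Hee : 0 < e).
  { apply Rmin_pos; [lra|]. apply Rdiv_lt_0_compat; [|lra]. apply Rmult_lt_0_compat; lra. }
  destruct (HF (mkposreal e Hee)) as [d1 Hd1]; simpl in Hd1.
  pose proof (proj1 (filterlim_locally _ _) Hc d1) as [d2 Hd2].
  destruct H0 as [d3 Hd3].
  assert (Hd : 0 < Rmin d1 (Rmin d2 d3)).
  { apply Rmin_pos; [apply cond_pos|apply Rmin_pos; apply cond_pos]. }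
  exists (mkposreal _ Hd); simpl; intros h Hh Hhd.
  assert (B1 : Rabs h < d1) by (eapply Rlt_le_trans; [exact Hhd|apply Rmin_l]).
  assert (B2 : Rabs h < d2)
    by (eapply Rlt_le_trans; [exact Hhd|eapply Rle_trans; [apply Rmin_r|apply Rmin_l]]).
  assert (B3 : Rabs h < d3)
    by (eapply Rlt_le_trans; [exact Hhd|eapply Rle_trans; [apply Rmin_r|apply Rmin_r]]).
  assert (Hs : F s (phi s) = 0).
  { apply Hd3; change (Rabs (s - s) < d3).
    rewrite Rminus_diag, Rabs_R0; apply cond_pos. }
  assert (Hsh : F (s + h) (phi (s + h)) = 0).
  { apply Hd3; change (Rabs (s + h - s) < d3).
    now replace (s + h - s) with h by ring. }
  assert (Hp : Rabs (phi (s + h) - phi s) < d1).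
  { apply (Hd2 (s + h)); change (Rabs (s + h - s) < d2).
    now replace (s + h - s) with h by ring. }
  assert (K := Hd1 (s + h) (phi (s + h))).
  replace (s + h - s) with h in K by ring.
  specialize (K B1 Hp); rewrite Hs, Hsh in K.
  set (D := phi (s + h) - phi s) in *.
  replace (0 - 0 - (l1 * h + l2 * D)) with (- (l1 * h + l2 * D)) in K by ring.
  rewrite Rabs_Ropp in K.
  assert (Hmax : Rmax (Rabs h) (Rabs D) <= Rabs h + Rabs D).
  { pose proof (Rabs_pos h); pose proof (Rabs_pos D); apply Rmax_lub; lra. }
  assert (K2 : Rabs (l1 * h + l2 * D) <= e * (Rabs h + Rabs D)).
  { eapply Rle_trans; [exact K|]; apply Rmult_le_compat_l; lra. }
  assert (Hh0 : 0 < Rabs h) by now apply Rabs_pos_lt.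
  assert (HD : Rabs D <= M * Rabs h).
  { assert (T1 : Rabs l2 * Rabs D <= Rabs (l1 * h + l2 * D) + Rabs l1 * Rabs h).
    { rewrite <- !Rabs_mult; replace (l2 * D) with ((l1 * h + l2 * D) - l1 * h) at 1 by ring.
      eapply Rle_trans; [apply Rabs_triang|]; rewrite Rabs_Ropp; lra. }
    assert (e <= Rabs l2 / 2) by apply Rmin_l.
    assert (T2 : e * (Rabs h + Rabs D) <= Rabs l2 / 2 * (Rabs h + Rabs D)).
    { apply Rmult_le_compat_r; [pose proof (Rabs_pos D); lra|assumption]. }
    apply (Rmult_le_reg_l (Rabs l2 / 2)); [lra|].
    replace (Rabs l2 / 2 * (M * Rabs h)) with ((Rabs l1 + Rabs l2 / 2) * Rabs h)
      by (unfold M; field; lra).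
    lra. }
  replace (D / h - - (l1 / l2)) with ((l1 * h + l2 * D) / (l2 * h)) by (field; split; auto).
  rewrite Rabs_div by (apply Rmult_integral_contrapositive_currified; auto).
  rewrite (Rabs_mult l2).
  apply (Rmult_lt_reg_r (Rabs l2 * Rabs h)); [now apply Rmult_lt_0_compat|].
  unfold Rdiv; rewrite Rmult_assoc, Rinv_l, Rmult_1_r
    by (apply Rgt_not_eq; now apply Rmult_lt_0_compat).
  assert (E1 : e * (1 + M) <= eps / 2 * Rabs l2).
  { apply Rle_trans with (eps / 2 * Rabs l2 / (1 + M) * (1 + M));
      [apply Rmult_le_compat_r; [lra|apply Rmin_r]|right; field; lra]. }
  apply Rle_lt_trans with (e * (1 + M) * Rabs h).
  { eapply Rle_trans; [exact K2|]; rewrite Rmult_assoc; apply Rmult_le_compat_l; lra. }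
  apply Rle_lt_trans with (eps / 2 * Rabs l2 * Rabs h); [apply Rmult_le_compat_r; lra|].
  assert (0 < eps * (Rabs l2 * Rabs h)) by (repeat apply Rmult_lt_0_compat; assumption).
  lra.
Qed.

Lemma smooth3_differentiable (Om : R -> R -> R -> Prop) (H : R -> R -> R -> R) (t x u : R) :
  open3 Om -> smooth3_n Om 1 H -> Om t x u ->
  differentiable_pt_lim (fun s v => H s x v) t u (Dt H t x u) (Du H t x u) /\
  differentiable_pt_lim (fun y v => H t y v) x u (Dx H t x u) (Du H t x u).
Proof.
  intros HO HS K; apply smooth3_n_S in HS; destruct HS as (_ & H2 & H3 & H4 & H5).
  destruct (open3_box Om t x u HO K) as [e He].
  pose proof (cond_pos e) as Hp.
  split; apply differentiable_of_C1.
  - exists e; intros s v Hs Hv.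
    assert (B : Om s x v) by (apply He; unfold box; rewrite Rminus_diag, Rabs_R0; auto).
    exact (proj1 (H2 s x v B)).
  - exact (proj2 (proj2 (H2 t x u K))).
  - exact (proj1 (continuous3_slices (Dt H) t x u (smooth3_n_cont Om 0 _ t x u H3 K))).
  - exists e; intros y v Hs Hv.
    assert (B : Om t y v) by (apply He; unfold box; rewrite Rminus_diag, Rabs_R0; auto).
    exact (proj1 (proj2 (H2 t y v B))).
  - exact (proj2 (proj2 (H2 t x u K))).
  - exact (proj1 (proj2 (continuous3_slices (Dx H) t x u (smooth3_n_cont Om 0 _ t x u H4 K)))).
Qed.

Lemma smooth3_is_derive_graph (Om : R -> R -> R -> Prop) (H : R -> R -> R -> R)
  (t x : R) (phi : R -> R) (l : R) :
  open3 Om -> smooth3_n Om 1 H ->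
  (Om t x (phi t) -> is_derive phi t l ->
   is_derive (fun s => H s x (phi s)) t (Dt H t x (phi t) + Du H t x (phi t) * l)) /\
  (Om t x (phi x) -> is_derive phi x l ->
   is_derive (fun y => H t y (phi y)) x (Dx H t x (phi x) + Du H t x (phi x) * l)).
Proof.
  intros HO HS; split; intros K D;
    destruct (smooth3_differentiable Om H _ _ _ HO HS K) as [H1 H2].
  - replace (Dt H t x (phi t)) with (Dt H t x (phi t) * 1) by ring.
    exact (is_derive_comp_2d (fun s v => H s x v) (fun s => s) phi t _ _ _ _ H1
             (is_derive_id t) D).
  - replace (Dx H t x (phi x)) with (Dx H t x (phi x) * 1) by ring.
    exact (is_derive_comp_2d (fun y v => H t y v) (fun y => y) phi x _ _ _ _ H2
             (is_derive_id x) D).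
Qed.

(** * Existence of implicit functions *)

Lemma increasing_of_pos_derive (f : R -> R) (u0 e : R) :
  (forall v, Rabs (v - u0) < e -> ex_derive f v /\ 0 < Derive f v) ->
  forall v w, Rabs (v - u0) < e -> Rabs (w - u0) < e -> v < w -> f v < f w.
Proof.
  intros H v w Hv Hw Hvw.
  assert (Hin : forall z, v <= z <= w -> Rabs (z - u0) < e).
  { intros z Hz; apply Rabs_def2 in Hv, Hw; apply Rabs_def1; lra. }
  destruct (MVT_gen f v w (Derive f)) as [c [Hc E]].
  - intros z; rewrite Rmin_left, Rmax_right by lra; intros Hz.
    apply Derive_correct, H, Hin; lra.
  - intros z; rewrite Rmin_left, Rmax_right by lra; intros Hz.
    apply derivable_continuous_pt, ex_derive_Reals_0, H, Hin, Hz.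
  - rewrite Rmin_left, Rmax_right in Hc by lra.
    destruct (H c (Hin c Hc)) as [_ P].
    assert (0 < Derive f c * (w - v)) by (apply Rmult_lt_0_compat; lra).
    lra.
Qed.

Lemma continuous3_pos (G : R -> R -> R -> R) (t x u : R) :
  continuous (uncurry3 G) (t, x, u) -> 0 < G t x u ->
  exists d : posreal, forall t' x' u', box d t x u t' x' u' -> 0 < G t' x' u'.
Proof.
  intros H P; destruct (continuous3_eps G t x u H (mkposreal _ P)) as [d Hd]; exists d.
  intros t' x' u' B; specialize (Hd t' x' u' B); simpl in Hd.
  apply Rabs_def2 in Hd; lra.
Qed.

(** On a box [Phi] increases in [u], with opposite signs at [u0 - h] and [u0 + h]; by continuity
    these signs persist for nearby [(t, x)], and the intermediate value theorem gives a zero, unique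
    by monotonicity. The same trapping between [f t x - r] and [f t x + r] proves continuity of
    [f]. *)
Lemma implicit_function_pos (Om : R -> R -> R -> Prop) (Phi : R -> R -> R -> R) (t0 x0 u0 : R) :
  open3 Om -> smooth3_n Om 1 Phi -> Om t0 x0 u0 ->
  Phi t0 x0 u0 = 0 -> 0 < Du Phi t0 x0 u0 ->
  exists (f : R -> R -> R) (d : posreal), f t0 x0 = u0 /\
    forall t x, Rabs (t - t0) < d -> Rabs (x - x0) < d ->
      Om t x (f t x) /\ Phi t x (f t x) = 0 /\ Du Phi t x (f t x) <> 0 /\
      continuity_2d_pt f t x.
Proof.
  intros HO HS K H0 HP.
  apply smooth3_n_S in HS; destruct HS as (C & Dv & _ & _ & S3).
  destruct (open3_box Om t0 x0 u0 HO K) as [e1 He1].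
  destruct (continuous3_pos (Du Phi) t0 x0 u0 (smooth3_n_cont Om 0 _ t0 x0 u0 S3 K) HP)
    as [e2 He2].
  assert (He : 0 < Rmin e1 e2) by (apply Rmin_pos; apply cond_pos).
  set (e := Rmin e1 e2) in *.
  assert (Hbox : forall t x u, box e t0 x0 u0 t x u -> Om t x u /\ 0 < Du Phi t x u).
  { intros t x u (B1 & B2 & B3).
    assert (e <= e1) by apply Rmin_l; assert (e <= e2) by apply Rmin_r.
    split; [apply He1|apply He2]; repeat split; eapply Rlt_le_trans; eauto. }
  assert (Hinc : forall t x, Rabs (t - t0) < e -> Rabs (x - x0) < e ->
    forall v w, Rabs (v - u0) < e -> Rabs (w - u0) < e -> v < w -> Phi t x v < Phi t x w).
  { intros t x Ht Hx; apply (increasing_of_pos_derive (fun v => Phi t x v)).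
    intros v Hv; destruct (Hbox t x v) as [B1 B2]; [repeat split; assumption|].
    split; [exact (proj2 (proj2 (Dv t x v B1)))|exact B2]. }
  set (h := e / 2).
  assert (Hh : 0 < h < e) by (unfold h; lra).
  assert (Hz : Rabs (t0 - t0) < e /\ Rabs (x0 - x0) < e /\ Rabs (u0 - u0) < e).
  { rewrite !Rminus_diag, Rabs_R0; lra. }
  assert (Hp : Rabs (u0 + h - u0) < e) by (apply Rabs_def1; lra).
  assert (Hm : Rabs (u0 - h - u0) < e) by (apply Rabs_def1; lra).
  assert (P1 : 0 < Phi t0 x0 (u0 + h)).
  { rewrite <- H0; apply Hinc; try apply Hz; auto; lra. }
  assert (P2 : 0 < - Phi t0 x0 (u0 - h)).
  { assert (Phi t0 x0 (u0 - h) < Phi t0 x0 u0) by (apply Hinc; try apply Hz; auto; lra). lra. }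
  assert (Kp : Om t0 x0 (u0 + h)) by (apply Hbox; repeat split; try apply Hz; auto).
  assert (Km : Om t0 x0 (u0 - h)) by (apply Hbox; repeat split; try apply Hz; auto).
  destruct (continuous3_pos Phi t0 x0 (u0 + h) (C _ _ _ Kp) P1) as [d1 Hd1].
  destruct (continuous3_pos (fun t x u => - Phi t x u) t0 x0 (u0 - h)
              (continuous_opp _ _ (C _ _ _ Km)) P2) as [d2 Hd2].
  assert (Hdp : 0 < Rmin e (Rmin d1 d2)).
  { apply Rmin_pos; [lra|apply Rmin_pos; apply cond_pos]. }
  set (d := Rmin e (Rmin d1 d2)) in *.
  assert (Hde : d <= e) by apply Rmin_l.
  assert (Hdd1 : d <= d1) by (eapply Rle_trans; [apply Rmin_r|apply Rmin_l]).
  assert (Hdd2 : d <= d2) by (eapply Rle_trans; [apply Rmin_r|apply Rmin_r]).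
  assert (Hs : forall t x, Rabs (t - t0) < d -> Rabs (x - x0) < d ->
     Phi t x (u0 - h) < 0 < Phi t x (u0 + h)).
  { intros t x Ht Hx; split.
    - enough (0 < - Phi t x (u0 - h)) by lra.
      apply Hd2; unfold box; rewrite Rminus_diag, Rabs_R0.
      repeat split; [lra|lra|apply cond_pos].
    - apply Hd1; unfold box; rewrite Rminus_diag, Rabs_R0.
      repeat split; [lra|lra|apply cond_pos]. }
  (* The strict bound by [h < e] keeps the zero away from the ends and leaves room for the margin
     [r] of the continuity argument. *)
  set (f := fun t x => epsilon (inhabits 0) (fun u => Rabs (u - u0) < h /\ Phi t x u = 0)).
  assert (Hf : forall t x, Rabs (t - t0) < d -> Rabs (x - x0) < d ->
     Rabs (f t x - u0) < h /\ Phi t x (f t x) = 0).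
  { intros t x Ht Hx; apply (epsilon_spec (inhabits 0)
      (fun u => Rabs (u - u0) < h /\ Phi t x u = 0)).
    destruct (Hs t x Ht Hx) as [S1 S2].
    destruct (IVT_interv (fun v => Phi t x v) (u0 - h) (u0 + h)) as [z [Hz1 Hz2]]; try lra.
    - intros v Hv; apply derivable_continuous_pt, ex_derive_Reals_0.
      assert (B : Om t x v) by (apply Hbox; repeat split; try lra; apply Rabs_def1; lra).
      exact (proj2 (proj2 (Dv t x v B))).
    - exists z; split; [|exact Hz2].
      assert (z <> u0 - h) by (intros ->; lra).
      assert (z <> u0 + h) by (intros ->; lra).
      apply Rabs_def1; lra. }
  exists f, (mkposreal d Hdp); split.
  - destruct (Hf t0 x0) as [F1 F2]; try (rewrite Rminus_diag, Rabs_R0; exact Hdp).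
    assert (Fe : Rabs (f t0 x0 - u0) < e) by lra.
    destruct (Rtotal_order (f t0 x0) u0) as [L|[L|L]]; [|exact L|].
    + pose proof (Hinc t0 x0 (proj1 Hz) (proj1 (proj2 Hz)) _ _ Fe (proj2 (proj2 Hz)) L); lra.
    + pose proof (Hinc t0 x0 (proj1 Hz) (proj1 (proj2 Hz)) _ _ (proj2 (proj2 Hz)) Fe L); lra.
  - simpl; intros t x Ht Hx; destruct (Hf t x Ht Hx) as [F1 F2].
    destruct (Hbox t x (f t x)) as [B1 B2]; [repeat split; lra|].
    split; [exact B1|]; split; [exact F2|]; split; [lra|].
    intros [eps Heps]; simpl.
    set (r := Rmin (eps / 2) ((h - Rabs (f t x - u0)) / 2)).
    assert (Hr : 0 < r) by (apply Rmin_pos; lra).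
    assert (Hr1 : r <= eps / 2) by apply Rmin_l.
    assert (Hr2 : r <= (h - Rabs (f t x - u0)) / 2) by apply Rmin_r.
    assert (Rp : Rabs (f t x + r - u0) < e).
    { replace (f t x + r - u0) with ((f t x - u0) + r) by ring.
      eapply Rle_lt_trans; [apply Rabs_triang|]; rewrite (Rabs_pos_eq r) by lra; lra. }
    assert (Rm : Rabs (f t x - r - u0) < e).
    { replace (f t x - r - u0) with ((f t x - u0) + - r) by ring.
      eapply Rle_lt_trans; [apply Rabs_triang|]; rewrite Rabs_Ropp, (Rabs_pos_eq r) by lra; lra. }
    assert (Fe : Rabs (f t x - u0) < e) by lra.
    assert (Ht' : Rabs (t - t0) < e) by lra.
    assert (Hx' : Rabs (x - x0) < e) by lra.
    assert (Q1 : 0 < Phi t x (f t x + r)).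
    { rewrite <- F2; apply Hinc; auto; lra. }
    assert (Q2 : 0 < - Phi t x (f t x - r)).
    { assert (Phi t x (f t x - r) < Phi t x (f t x)) by (apply Hinc; auto; lra). lra. }
    assert (Lp : Om t x (f t x + r)) by (apply Hbox; repeat split; auto).
    assert (Lm : Om t x (f t x - r)) by (apply Hbox; repeat split; auto).
    destruct (continuous3_pos Phi t x (f t x + r) (C _ _ _ Lp) Q1) as [g1 Hg1].
    destruct (continuous3_pos (fun t x u => - Phi t x u) t x (f t x - r)
              (continuous_opp _ _ (C _ _ _ Lm)) Q2) as [g2 Hg2].
    assert (Hg : 0 < Rmin (Rmin g1 g2) (Rmin (d - Rabs (t - t0)) (d - Rabs (x - x0)))).
    { repeat apply Rmin_pos; try apply cond_pos; lra. }
    exists (mkposreal _ Hg); simpl; intros s y Hs1 Hy1.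
    assert (G1 : Rmin (Rmin g1 g2) (Rmin (d - Rabs (t - t0)) (d - Rabs (x - x0))) <= g1)
      by (eapply Rle_trans; [apply Rmin_l|apply Rmin_l]).
    assert (G2 : Rmin (Rmin g1 g2) (Rmin (d - Rabs (t - t0)) (d - Rabs (x - x0))) <= g2)
      by (eapply Rle_trans; [apply Rmin_l|apply Rmin_r]).
    assert (G3 : Rmin (Rmin g1 g2) (Rmin (d - Rabs (t - t0)) (d - Rabs (x - x0)))
      <= d - Rabs (t - t0)) by (eapply Rle_trans; [apply Rmin_r|apply Rmin_l]).
    assert (G4 : Rmin (Rmin g1 g2) (Rmin (d - Rabs (t - t0)) (d - Rabs (x - x0)))
      <= d - Rabs (x - x0)) by (eapply Rle_trans; [apply Rmin_r|apply Rmin_r]).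
    assert (Hs2 : Rabs (s - t0) < d).
    { replace (s - t0) with ((s - t) + (t - t0)) by ring.
      eapply Rle_lt_trans; [apply Rabs_triang|]; lra. }
    assert (Hy2 : Rabs (y - x0) < d).
    { replace (y - x0) with ((y - x) + (x - x0)) by ring.
      eapply Rle_lt_trans; [apply Rabs_triang|]; lra. }
    destruct (Hf s y Hs2 Hy2) as [F3 F4].
    assert (V1 : 0 < Phi s y (f t x + r)).
    { apply Hg1; unfold box; rewrite Rminus_diag, Rabs_R0.
      repeat split; [lra|lra|apply cond_pos]. }
    assert (V2 : 0 < - Phi s y (f t x - r)).
    { apply Hg2; unfold box; rewrite Rminus_diag, Rabs_R0.
      repeat split; [lra|lra|apply cond_pos]. }
    assert (Hs' : Rabs (s - t0) < e) by lra.
    assert (Hy' : Rabs (y - x0) < e) by lra.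
    assert (Fe' : Rabs (f s y - u0) < e) by lra.
    assert (W1 : f s y < f t x + r).
    { destruct (Rlt_le_dec (f s y) (f t x + r)) as [L|[L|L]]; [exact L| |].
      - pose proof (Hinc s y Hs' Hy' _ _ Rp Fe' L); lra.
      - rewrite <- L in F4; lra. }
    assert (W2 : f t x - r < f s y).
    { destruct (Rlt_le_dec (f t x - r) (f s y)) as [L|[L|L]]; [exact L| |].
      - pose proof (Hinc s y Hs' Hy' _ _ Fe' Rm L); lra.
      - rewrite L in F4; lra. }
    apply Rabs_def1; lra.
Qed.

(** A negative derivative becomes positive for [-1 * Phi], which has the same zeros. *)
Lemma implicit_function (Om : R -> R -> R -> Prop) (Phi : R -> R -> R -> R) (t0 x0 u0 : R) :
  open3 Om -> smooth3_n Om 1 Phi -> Om t0 x0 u0 ->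
  Phi t0 x0 u0 = 0 -> Du Phi t0 x0 u0 <> 0 ->
  exists (f : R -> R -> R) (d : posreal), f t0 x0 = u0 /\
    forall t x, Rabs (t - t0) < d -> Rabs (x - x0) < d ->
      Om t x (f t x) /\ Phi t x (f t x) = 0 /\ Du Phi t x (f t x) <> 0 /\
      continuity_2d_pt f t x.
Proof.
  intros HO HS K H0 HP.
  destruct (Rlt_le_dec 0 (Du Phi t0 x0 u0)) as [L|L];
    [now apply implicit_function_pos|].
  assert (ED : forall t x u, Du (fun t x u => -1 * Phi t x u) t x u = -1 * Du Phi t x u)
    by (intros; apply (Derive_scal (fun v => Phi t x v))).
  destruct (implicit_function_pos Om (fun t x u => -1 * Phi t x u) t0 x0 u0)
    as (f & d & F1 & F2); auto.
  - apply (smooth3_n_mult Om HO 1 (fun _ _ _ => -1)); [apply smooth3_n_const|exact HS].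
  - rewrite H0; ring.
  - rewrite ED; lra.
  - exists f, d; split; [exact F1|]; intros t x Ht Hx.
    destruct (F2 t x Ht Hx) as (G1 & G2 & G3 & G4); rewrite ED in G3.
    repeat split; auto; lra.
Qed.

Lemma smooth3_n_subset (Om Om' : R -> R -> R -> Prop) (n : nat) (F : R -> R -> R -> R) :
  (forall t x u, Om' t x u -> Om t x u) -> smooth3_n Om n F -> smooth3_n Om' n F.
Proof. intros H HF t x u K; apply HF, H, K. Qed.

Lemma open3_nonzero (Om : R -> R -> R -> Prop) (G : R -> R -> R -> R) :
  open3 Om -> smooth3_n Om 0 G -> open3 (fun t x u => Om t x u /\ G t x u <> 0).
Proof.
  intros HO HG [[t x] u] [K N]; simpl in K, N.
  pose proof (smooth3_n_cont Om 0 G t x u HG K) as C.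
  apply locally_box.
  destruct (open3_box Om t x u HO K) as [e1 He1].
  destruct (continuous3_eps G t x u C (mkposreal _ (Rabs_pos_lt _ N))) as [e2 He2].
  assert (He : 0 < Rmin e1 e2) by (apply Rmin_pos; apply cond_pos).
  exists (mkposreal _ He); simpl; intros s y v (B1 & B2 & B3).
  pose proof (Rmin_l e1 e2); pose proof (Rmin_r e1 e2).
  split; [apply He1; repeat split; lra|].
  intros E; assert (L : Rabs (G s y v - G t x u) < Rabs (G t x u))
    by (apply He2; repeat split; lra).
  rewrite E, Rminus_0_l, Rabs_Ropp in L; lra.
Qed.

(** * Smoothness of an implicit function to every order *)

Section Implicit.
Variables (Om : R -> R -> R -> Prop) (Phi : R -> R -> R -> R) (f : R -> R -> R)
  (t0 x0 : R) (d : posreal).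
Hypothesis HO : open3 Om.
Hypothesis HS : smooth3_on Om Phi.
Hypothesis Hf : forall t x, Rabs (t - t0) < d -> Rabs (x - x0) < d ->
      Om t x (f t x) /\ Phi t x (f t x) = 0 /\ Du Phi t x (f t x) <> 0 /\
      continuity_2d_pt f t x.

Let HSn : forall n, smooth3_n Om n Phi.
Proof. intros n t x u K; now apply HS. Qed.

Lemma locally_square (t x : R) : Rabs (t - t0) < d -> Rabs (x - x0) < d ->
  locally_2d (fun s y => Rabs (s - t0) < d /\ Rabs (y - x0) < d) t x.
Proof.
  intros Ht Hx.
  assert (H : 0 < Rmin (d - Rabs (t - t0)) (d - Rabs (x - x0))) by (apply Rmin_pos; lra).
  exists (mkposreal _ H); simpl; intros s y Hs Hy.
  pose proof (Rmin_l (d - Rabs (t - t0)) (d - Rabs (x - x0))).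
  pose proof (Rmin_r (d - Rabs (t - t0)) (d - Rabs (x - x0))).
  split.
  - replace (s - t0) with ((s - t) + (t - t0)) by ring.
    eapply Rle_lt_trans; [apply Rabs_triang|]; lra.
  - replace (y - x0) with ((y - x) + (x - x0)) by ring.
    eapply Rle_lt_trans; [apply Rabs_triang|]; lra.
Qed.

Lemma implicit_derivatives (t x : R) : Rabs (t - t0) < d -> Rabs (x - x0) < d ->
  is_derive (fun s => f s x) t (- (Dt Phi t x (f t x) / Du Phi t x (f t x))) /\
  is_derive (fun y => f t y) x (- (Dx Phi t x (f t x) / Du Phi t x (f t x))).
Proof.
  intros Ht Hx; destruct (Hf t x Ht Hx) as (K & H0 & HN & HC).
  destruct (smooth3_differentiable Om Phi _ _ _ HO (HSn 1) K) as [D1 D2].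
  pose proof (locally_square t x Ht Hx) as L.
  split.
  - apply (implicit_is_derive (fun s v => Phi s x v) (fun s => f s x)); auto.
    + intros P [eps HP]; destruct (HC eps) as [dd Hdd]; exists dd; intros s Hs.
      apply HP; apply Hdd; [exact Hs|rewrite Rminus_diag, Rabs_R0; apply cond_pos].
    + apply locally_2d_1d_const_y in L; revert L; apply filter_imp.
      intros s [L1 L2]; now apply Hf.
  - apply (implicit_is_derive (fun y v => Phi t y v) (fun y => f t y)); auto.
    + intros P [eps HP]; destruct (HC eps) as [dd Hdd]; exists dd; intros s Hs.
      apply HP; apply Hdd; [rewrite Rminus_diag, Rabs_R0; apply cond_pos|exact Hs].
    + apply locally_2d_1d_const_x in L; revert L; apply filter_imp.
      intros s [L1 L2]; now apply Hf.
Qed.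

Let Om' := fun t x u => Om t x u /\ Du Phi t x u <> 0.

Let HO' : open3 Om'.
Proof. apply open3_nonzero; [exact HO|]. apply (smooth3_n_S Om 0 Phi), HSn. Qed.

(* The derivatives of [H (t, x, f t x)] are again of this form, since
   f_t = - Phi_t / Phi_u and f_x = - Phi_x / Phi_u at u = f. *)
Lemma ex_diff_n_graph (n : nat) :
  forall H, smooth3_n Om' n H ->
  forall t x, Rabs (t - t0) < d -> Rabs (x - x0) < d ->
  ex_diff_n (fun t x => H t x (f t x)) n t x.
Proof.
  assert (HC : forall m H, smooth3_n Om' m H -> forall t x,
    Rabs (t - t0) < d -> Rabs (x - x0) < d ->
    continuity_2d_pt (fun t x => H t x (f t x)) t x).
  { intros m H HH t x Ht Hx; destruct (Hf t x Ht Hx) as (K & H0 & HN & HC).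
    intros eps.
    destruct (continuous3_eps H t x (f t x)
      (smooth3_n_cont Om' m H t x (f t x) HH (conj K HN)) eps) as [e He].
    destruct (HC e) as [dd Hdd].
    assert (Hm : 0 < Rmin e dd) by (apply Rmin_pos; apply cond_pos).
    exists (mkposreal _ Hm); simpl; intros s y Hs Hy.
    pose proof (Rmin_l e dd); pose proof (Rmin_r e dd).
    apply He; repeat split; [lra|lra|]; apply Hdd; lra. }
  assert (H1 : forall H, smooth3_n Om' 1 H -> forall t x,
    Rabs (t - t0) < d -> Rabs (x - x0) < d ->
    is_derive (fun s => H s x (f s x)) t (Dt H t x (f t x) +
      Du H t x (f t x) * (- (Dt Phi t x (f t x) / Du Phi t x (f t x)))) /\
    is_derive (fun y => H t y (f t y)) x (Dx H t x (f t x) +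
      Du H t x (f t x) * (- (Dx Phi t x (f t x) / Du Phi t x (f t x))))).
  { intros H HH t x Ht Hx; destruct (Hf t x Ht Hx) as (K & H0 & HN & _).
    destruct (implicit_derivatives t x Ht Hx) as [D1 D2].
    split.
    - apply (proj1 (smooth3_is_derive_graph Om' H t x (fun s => f s x) _ HO' HH)); auto.
      split; auto.
    - apply (proj2 (smooth3_is_derive_graph Om' H t x (fun y => f t y) _ HO' HH)); auto.
      split; auto. }
  induction n as [|n IH]; intros H HH t x Ht Hx.
  - split; [now apply (HC 0%nat)|exact I].
  - assert (HH1 : smooth3_n Om' 1 H) by (clear -HH; induction n; auto using smooth3_n_pred).
    destruct (H1 H HH1 t x Ht Hx) as [D1 D2].
    split; [now apply (HC (S n))|].
    split; [eexists; exact D1|]; split; [eexists; exact D2|].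
    assert (Sub : forall G, smooth3_n Om n G -> smooth3_n Om' n G).
    { intros G; apply smooth3_n_subset; intros a b c []; auto. }
    apply smooth3_n_S in HH; destruct HH as (_ & _ & S1 & S2 & S3).
    destruct (proj1 (smooth3_n_S _ _ _) (HSn (S n))) as (_ & _ & R1 & R2 & R3).
    assert (Q : forall A B, smooth3_n Om' n A -> smooth3_n Om' n B ->
      smooth3_n Om' n (fun t x u => A t x u + Du H t x u * (-1 * (B t x u * / Du Phi t x u)))).
    { intros A B HA HB; apply smooth3_n_plus; [exact HO'|exact HA|].
      apply smooth3_n_mult; [exact HO'|exact S3|].
      apply (smooth3_n_mult Om' HO' n (fun _ _ _ => -1)); [apply smooth3_n_const|].
      apply smooth3_n_mult; [exact HO'|exact HB|].
      apply smooth3_n_inv; [exact HO'|intros a b c [_ N]; exact N|now apply Sub]. }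
    pose proof (locally_square t x Ht Hx) as L.
    split.
    + eapply ex_diff_n_ext_loc;
        [|exact (IH _ (Q (Dt H) (Dt Phi) S1 (Sub _ R1)) t x Ht Hx)].
      revert L; apply locally_2d_impl, locally_2d_forall; intros s y [Hs Hy].
      symmetry; apply is_derive_unique.
      destruct (Hf s y Hs Hy) as (_ & _ & HN & _).
      replace (-1 * _) with (- (Dt Phi s y (f s y) / Du Phi s y (f s y)))
        by (now field).
      now apply (H1 H HH1 s y).
    + eapply ex_diff_n_ext_loc;
        [|exact (IH _ (Q (Dx H) (Dx Phi) S2 (Sub _ R2)) t x Ht Hx)].
      revert L; apply locally_2d_impl, locally_2d_forall; intros s y [Hs Hy].
      symmetry; apply is_derive_unique.
      destruct (Hf s y Hs Hy) as (_ & _ & HN & _).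
      replace (-1 * _) with (- (Dx Phi s y (f s y) / Du Phi s y (f s y)))
        by (now field).
      now apply (H1 H HH1 s y).
Qed.

End Implicit.

(** * Uniqueness of Taylor expansions *)

Definition smooth1_near (f : R -> R) (x : R) : Prop :=
  locally x (fun y => forall n, ex_derive_n f n y).

Definition punctured (x0 x : R) : Prop := x <> x0.

Lemma limit1_in_ext_loc (f g : R -> R) (l x0 : R) :
  locally x0 (fun x => f x = g x) ->
  limit1_in f (punctured x0) l x0 -> limit1_in g (punctured x0) l x0.
Proof.
  intros [d Hd] H eps He; destruct (H eps He) as [a [Ha1 Ha2]].
  exists (Rmin a d); split; [apply Rmin_pos; [exact Ha1|apply cond_pos]|].
  intros x [Px Hx]; simpl in x, Hx; unfold Rdist in Hx.
  rewrite <- Hd.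
  - apply Ha2; split; [exact Px|eapply Rlt_le_trans; [exact Hx|apply Rmin_l]].
  - eapply Rlt_le_trans; [exact Hx|apply Rmin_r].
Qed.

Lemma limit1_in_slope (f : R -> R) (x0 l : R) :
  is_derive f x0 l ->
  limit1_in (fun x => (f x - f x0) / (x - x0)) (punctured x0) l x0.
Proof.
  intros H eps He; apply is_derive_Reals in H; destruct (H eps He) as [d Hd].
  exists d; split; [apply cond_pos|]; intros x [Px Hx]; simpl in x, Hx.
  unfold Rdist in Hx; simpl; unfold Rdist.
  specialize (Hd (x - x0) (Rminus_eq_contra _ _ Px) Hx).
  now replace (x0 + (x - x0)) with x in Hd by ring.
Qed.

Lemma limit1_in_continuous (f : R -> R) (x0 : R) :
  continuous f x0 -> limit1_in f (punctured x0) (f x0) x0.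
Proof.
  intros H eps He.
  destruct (proj1 (filterlim_locally _ _) H (mkposreal eps He)) as [d Hd].
  exists d; split; [apply cond_pos|]; intros x [Px Hx]; now apply (Hd x).
Qed.

Lemma limit1_in_pow (f : R -> R) (D : R -> Prop) (l x0 : R) (n : nat) :
  limit1_in f D l x0 -> limit1_in (fun x => f x ^ n) D (l ^ n) x0.
Proof.
  intros H; induction n as [|n IH]; [apply (limit_free (fun _ => 1) D 0)|].
  now apply (limit_mul f (fun x => f x ^ n)).
Qed.

Lemma limit1_in_const (c : R) (D : R -> Prop) (x0 : R) : limit1_in (fun _ => c) D c x0.
Proof. apply (limit_free (fun _ => c) D 0). Qed.

(** Intended for points supplied by the mean value theorem, about whose dependence on [x] nothing is
    known: lying between two functions with common value and slope at [x0] forces the same slope on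
    them. *)
Lemma is_derive_squeeze (f g z : R -> R) (x0 l : R) :
  is_derive f x0 l -> is_derive g x0 l -> f x0 = g x0 ->
  locally x0 (fun x => Rmin (f x) (g x) <= z x <= Rmax (f x) (g x)) ->
  is_derive z x0 l.
Proof.
  intros Hf Hg E Hz.
  assert (Ez : z x0 = f x0).
  { pose proof (locally_singleton _ _ Hz) as K; simpl in K.
    rewrite <- E, Rmin_left, Rmax_left in K; lra. }
  destruct Hz as [d0 Hd0].
  apply is_derive_Reals; apply is_derive_Reals in Hf, Hg; intros eps He.
  destruct (Hf eps He) as [d1 H1]; destruct (Hg eps He) as [d2 H2].
  assert (Hm : 0 < Rmin d0 (Rmin d1 d2)) by (repeat apply Rmin_pos; apply cond_pos).
  exists (mkposreal _ Hm); simpl; intros h Hh Hb.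
  pose proof (Rmin_l d0 (Rmin d1 d2)); pose proof (Rmin_r d0 (Rmin d1 d2)).
  pose proof (Rmin_l d1 d2); pose proof (Rmin_r d1 d2).
  assert (B1 : Rabs h < d1) by lra; assert (B2 : Rabs h < d2) by lra.
  specialize (H1 h Hh B1); specialize (H2 h Hh B2).
  assert (K : Rmin (f (x0 + h)) (g (x0 + h)) <= z (x0 + h) <= Rmax (f (x0 + h)) (g (x0 + h))).
  { apply Hd0; change (Rabs (x0 + h - x0) < d0); replace (x0 + h - x0) with h by ring; lra. }
  rewrite Ez; rewrite <- E in H2.
  apply Rabs_def2 in H1, H2.
  assert (C : forall a b, b = a * h -> b / h = a) by (intros a b ->; now field).
  assert (Hbnd : forall v w, (v - f x0) / h - l < eps -> - eps < (v - f x0) / h - l ->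
     (w - f x0) / h - l < eps -> - eps < (w - f x0) / h - l -> v <= z (x0 + h) <= w ->
     Rabs ((z (x0 + h) - f x0) / h - l) < eps).
  { intros v w V1 V2 W1 W2 [Z1 Z2].
    destruct (Rtotal_order 0 h) as [P|[P|P]]; [|congruence|].
    - assert (I := Rinv_0_lt_compat h P).
      apply Rabs_def1.
      + eapply Rle_lt_trans; [|exact W1]. apply Rplus_le_compat_r, Rmult_le_compat_r; lra.
      + eapply Rlt_le_trans; [exact V2|]. apply Rplus_le_compat_r, Rmult_le_compat_r; lra.
    - assert (I := Rinv_lt_0_compat h P).
      apply Rabs_def1.
      + eapply Rle_lt_trans; [|exact V1]. unfold Rdiv; rewrite !(Rmult_comm _ (/ h)).
        apply Rplus_le_compat_r, Rmult_le_compat_neg_l; lra.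
      + eapply Rlt_le_trans; [exact W2|]. unfold Rdiv; rewrite !(Rmult_comm _ (/ h)).
        apply Rplus_le_compat_r, Rmult_le_compat_neg_l; lra. }
  destruct (Rle_dec (f (x0 + h)) (g (x0 + h))) as [L|L].
  - rewrite Rmin_left, Rmax_right in K by lra. apply (Hbnd (f (x0 + h)) (g (x0 + h))); lra.
  - rewrite Rmin_right, Rmax_left in K by lra. apply (Hbnd (g (x0 + h)) (f (x0 + h))); lra.
Qed.

Lemma Rabs_le_mult_small (c K d : R) :
  0 < d -> (forall y, 0 < y < d -> Rabs c <= K * y) -> c = 0.
Proof.
  intros Hd H; destruct (Req_dec c 0) as [E|N]; [exact E|exfalso].
  apply Rabs_pos_lt in N.
  assert (HK : 0 < K).
  { specialize (H (d / 2)); apply (Rmult_lt_reg_r (d / 2)); lra. }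
  assert (P : 0 < Rabs c / (2 * K)) by (apply Rdiv_lt_0_compat; lra).
  set (y := Rmin (d / 2) (Rabs c / (2 * K))).
  assert (Hy : 0 < y) by (apply Rmin_pos; lra).
  assert (y <= d / 2) by apply Rmin_l.
  assert (Y2 : y <= Rabs c / (2 * K)) by apply Rmin_r.
  specialize (H y ltac:(lra)).
  apply (Rmult_le_compat_l K) in Y2; [|lra].
  replace (K * (Rabs c / (2 * K))) with (Rabs c / 2) in Y2 by (field; lra).
  lra.
Qed.

Lemma Rabs_sum_bound (c : nat -> R) (n : nat) (y : R) :
  0 < y <= 1 -> Rabs (sum_f_R0 (fun k => c k * y ^ k) n) <= sum_f_R0 (fun k => Rabs (c k)) n.
Proof.
  intros Hy; eapply Rle_trans; [apply Rsum_abs|]; apply sum_Rle; intros k _.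
  rewrite Rabs_mult, <- (Rmult_1_r (Rabs (c k))) at 1.
  rewrite Rmult_1_r; rewrite <- (Rmult_1_r (Rabs (c k))) at 2.
  apply Rmult_le_compat_l; [apply Rabs_pos|].
  rewrite Rabs_pos_eq by (apply pow_le; lra).
  rewrite <- (pow1 k); apply pow_incr; lra.
Qed.

(** Small [y] force the constant coefficient to vanish; division by [y] then leaves the same
    hypothesis one degree lower. Positive [y] suffice, which matches the one-sided Taylor-Lagrange
    formula used next. *)
Lemma small_polynomial (n : nat) : forall c : nat -> R,
  (forall eps, 0 < eps -> exists d, 0 < d /\ forall y, 0 < y < d ->
     Rabs (sum_f_R0 (fun k => c k * y ^ k) n) <= eps * y ^ n) ->
  forall k, (k <= n)%nat -> c k = 0.
Proof.
  induction n as [|n IH]; intros c H k Hk.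
  - assert (k = 0%nat) by lia; subst k.
    destruct (Req_dec (c 0%nat) 0) as [E|N]; [exact E|exfalso].
    apply Rabs_pos_lt in N.
    destruct (H (Rabs (c 0%nat) / 2)) as [d [Hd H1]]; [lra|].
    specialize (H1 (d / 2)); simpl in H1; rewrite !Rmult_1_r in H1; lra.
  - assert (D : forall y, sum_f_R0 (fun k => c k * y ^ k) (S n) =
       c 0%nat + y * sum_f_R0 (fun k => c (S k) * y ^ k) n).
    { intros y; rewrite decomp_sum by lia; simpl Init.Nat.pred.
      rewrite scal_sum; f_equal; [simpl; ring|].
      apply sum_eq; intros; simpl; ring. }
    assert (C0 : c 0%nat = 0).
    { destruct (H 1) as [d [Hd H1]]; [lra|].
      apply (Rabs_le_mult_small _ (1 + sum_f_R0 (fun k => Rabs (c (S k))) n) (Rmin d 1));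
        [apply Rmin_pos; lra|].
      intros y [Y1 Y2].
      assert (Y3 : y < d) by (eapply Rlt_le_trans; [exact Y2|apply Rmin_l]).
      assert (Y4 : y < 1) by (eapply Rlt_le_trans; [exact Y2|apply Rmin_r]).
      specialize (H1 y (conj Y1 Y3)); rewrite D in H1.
      pose proof (Rabs_sum_bound (fun k => c (S k)) n y ltac:(lra)) as H2.
      set (S := sum_f_R0 (fun k => c (Datatypes.S k) * y ^ k) n) in *.
      assert (H3 : 1 * y ^ Datatypes.S n <= y).
      { rewrite Rmult_1_l; simpl; rewrite <- (Rmult_1_r y) at 3.
        apply Rmult_le_compat_l; [lra|]. rewrite <- (pow1 n); apply pow_incr; lra. }
      replace (c 0%nat) with ((c 0%nat + y * S) + - (y * S)) by ring.
      eapply Rle_trans; [apply Rabs_triang|].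
      rewrite Rabs_Ropp, Rabs_mult, (Rabs_pos_eq y) by lra.
      assert (y * Rabs S <= y * sum_f_R0 (fun k => Rabs (c (Datatypes.S k))) n)
        by (apply Rmult_le_compat_l; lra).
      lra. }
    destruct k as [|k]; [exact C0|].
    apply (IH (fun k => c (S k))); [|lia].
    intros eps He; destruct (H eps He) as [d [Hd H1]].
    exists d; split; [exact Hd|]; intros y Hy; specialize (H1 y Hy).
    rewrite D, C0, Rplus_0_l, Rabs_mult, (Rabs_pos_eq y) in H1 by lra.
    apply (Rmult_le_reg_l y); [lra|]; simpl in H1; lra.
Qed.

(** The Taylor polynomial of [D] and the polynomial with coefficients [p] both approximate [D] up to
    [o((x - x0)^n)], so [small_polynomial] applies to their difference. High derivatives are thereby
    obtained from a limit of quotients, without repeated differentiation. *)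
Lemma taylor_unique (D : R -> R) (n : nat) (x0 : R) (p : nat -> R) :
  smooth1_near D x0 ->
  limit1_in (fun x => (D x - sum_f_R0 (fun k => p k * (x - x0) ^ k) n) / (x - x0) ^ n)
    (punctured x0) 0 x0 ->
  forall k, (k <= n)%nat -> Derive_n D k x0 = INR (Factorial.fact k) * p k.
Proof.
  intros [d0 H0] HL k Hk.
  assert (Hx0 : forall m, ex_derive_n D m x0) by (apply H0, ball_center).
  (* A bound on the derivative of order [n + 1] near [x0] controls the Lagrange remainder although
     its intermediate point is unknown. *)
  assert (HB : exists M d1, 0 < d1 /\ forall y, Rabs (y - x0) < d1 ->
     Rabs (Derive_n D (S n) y) <= M).
  { assert (C : continuous (Derive_n D (S n)) x0)
      by exact (ex_derive_continuous _ _ (Hx0 (S (S n)))).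
    destruct (proj1 (filterlim_locally _ _) C (mkposreal 1 Rlt_0_1)) as [d1 H1].
    exists (Rabs (Derive_n D (S n) x0) + 1), d1; split; [apply cond_pos|].
    intros y Hy; specialize (H1 y Hy).
    change (Rabs (Derive_n D (S n) y - Derive_n D (S n) x0) < 1) in H1.
    replace (Derive_n D (S n) y) with
      ((Derive_n D (S n) y - Derive_n D (S n) x0) + Derive_n D (S n) x0) by ring.
    eapply Rle_trans; [apply Rabs_triang|]; lra. }
  destruct HB as (M & d1 & Hd1 & HM).
  assert (HM0 : 0 <= M).
  { eapply Rle_trans; [apply Rabs_pos|apply (HM x0)]; rewrite Rminus_diag, Rabs_R0; exact Hd1. }
  enough (E : Derive_n D k x0 / INR (Factorial.fact k) - p k = 0).
  { pose proof (INR_fact_neq_0 k).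
    replace (p k) with (Derive_n D k x0 / INR (Factorial.fact k)) by lra; now field. }
  apply (small_polynomial n (fun k => Derive_n D k x0 / INR (Factorial.fact k) - p k));
    [|exact Hk].
  intros eps He.
  destruct (HL (eps / 2)) as [d2 [Hd2 HL2]]; [lra|].
  (* For [y] below this radius the remainder takes at most [eps / 2 * y^n]; the limit hypothesis
     takes the other half. Using [M + 1] keeps the denominator positive. *)
  assert (Pm : 0 < eps / (2 * (M + 1))) by (apply Rdiv_lt_0_compat; lra).
  exists (Rmin (Rmin d0 d1) (Rmin d2 (eps / (2 * (M + 1))))); split.
  { repeat apply Rmin_pos; auto; apply cond_pos. }
  intros y [Y0 Y].
  assert (Y1 : y < d0) by (eapply Rlt_le_trans; [exact Y|eapply Rle_trans; [apply Rmin_l|apply Rmin_l]]).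
  assert (Y2 : y < d1) by (eapply Rlt_le_trans; [exact Y|eapply Rle_trans; [apply Rmin_l|apply Rmin_r]]).
  assert (Y3 : y < d2) by (eapply Rlt_le_trans; [exact Y|eapply Rle_trans; [apply Rmin_r|apply Rmin_l]]).
  assert (Y4 : y < eps / (2 * (M + 1))) by (eapply Rlt_le_trans; [exact Y|eapply Rle_trans; [apply Rmin_r|apply Rmin_r]]).
  destruct (Taylor_Lagrange D n x0 (x0 + y)) as (z & Hz & E); [lra| |].
  { intros t Ht m _; apply H0; change (Rabs (t - x0) < d0); rewrite Rabs_pos_eq; lra. }
  replace (x0 + y - x0) with y in E by ring.
  specialize (HL2 (x0 + y)); simpl in HL2; unfold Rdist in HL2.
  replace (x0 + y - x0) with y in HL2 by ring.
  assert (L : Rabs ((D (x0 + y) - sum_f_R0 (fun k => p k * y ^ k) n) / y ^ n - 0) < eps / 2).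
  { apply HL2; split; [unfold punctured; lra|rewrite Rabs_pos_eq; lra]. }
  assert (Hyn : 0 < y ^ n) by (apply pow_lt; lra).
  rewrite Rminus_0_r, Rabs_div, (Rabs_pos_eq (y ^ n)) in L by lra.
  apply (Rmult_lt_compat_r (y ^ n)) in L; [|exact Hyn].
  unfold Rdiv in L at 1; rewrite Rmult_assoc, Rinv_l, Rmult_1_r in L by lra.
  rewrite E in L.
  set (Rm := y ^ S n / INR (Factorial.fact (S n)) * Derive_n D (S n) z) in *.
  assert (HR : Rabs Rm <= eps / 2 * y ^ n).
  { unfold Rm; rewrite Rabs_mult, Rabs_div by apply INR_fact_neq_0.
    rewrite (Rabs_pos_eq (y ^ S n)) by (apply pow_le; lra).
    rewrite (Rabs_pos_eq (INR _)) by apply pos_INR.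
    assert (F1 : 1 <= INR (Factorial.fact (S n))).
    { apply (le_INR 1); apply Factorial.lt_O_fact. }
    assert (HD : Rabs (Derive_n D (S n) z) <= M + 1).
    { assert (Rabs (Derive_n D (S n) z) <= M) by (apply HM; rewrite Rabs_pos_eq; lra). lra. }
    assert (I : / INR (Factorial.fact (S n)) <= 1).
    { rewrite <- Rinv_1; apply Rinv_le_contravar; lra. }
    assert (HI : 0 < / INR (Factorial.fact (S n))) by (apply Rinv_0_lt_compat; lra).
    apply Rle_trans with (y * y ^ n * 1 * (M + 1)).
    - apply Rmult_le_compat; [|apply Rabs_pos| |exact HD].
      + apply Rmult_le_pos; [apply pow_le|]; lra.
      + simpl pow; apply Rmult_le_compat; try lra. apply Rmult_le_pos; lra.
    - apply (Rmult_lt_compat_r (M + 1)) in Y4; [|lra].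
      replace (eps / (2 * (M + 1)) * (M + 1)) with (eps / 2) in Y4 by (field; lra).
      replace (y * y ^ n * 1 * (M + 1)) with (y * (M + 1) * y ^ n) by ring.
      apply Rmult_le_compat_r; lra. }
  replace (sum_f_R0 (fun k => (Derive_n D k x0 / INR (Factorial.fact k) - p k) * y ^ k) n)
    with ((sum_f_R0 (fun m => y ^ m / INR (Factorial.fact m) * Derive_n D m x0) n + Rm
      - sum_f_R0 (fun k => p k * y ^ k) n) + - Rm).
  - eapply Rle_trans; [apply Rabs_triang|]; rewrite Rabs_Ropp; lra.
  - transitivity (sum_f_R0 (fun m => y ^ m / INR (Factorial.fact m) * Derive_n D m x0) n
      - sum_f_R0 (fun k => p k * y ^ k) n); [ring|].
    rewrite <- minus_sum; apply sum_eq; intros i _; field; apply INR_fact_neq_0.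
Qed.

Lemma smooth2_slice (f : R -> R -> R) (t x : R) :
  smooth2_near f t x -> smooth1_near (fun y => f t y) x.
Proof.
  intros H; apply locally_2d_1d_const_x in H; unfold smooth1_near; revert H; apply filter_imp.
  intros y Hy n; destruct n as [|n]; [exact I|].
  apply (ex_diff_n_ex_deriv_inf_2 (S (S n)) 0 n); [lia|apply Hy].
Qed.

Lemma smooth1_near_minus (f g : R -> R) (x : R) :
  smooth1_near f x -> smooth1_near g x ->
  smooth1_near (fun y => f y - g y) x /\
  forall n, Derive_n (fun y => f y - g y) n x = Derive_n f n x - Derive_n g n x.
Proof.
  unfold smooth1_near; intros Hf Hg; split.
  - apply locally_locally in Hf; apply locally_locally in Hg.
    generalize (filter_and _ _ Hf Hg); apply filter_imp; intros y [Kf Kg] n.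
    apply ex_derive_n_minus; [revert Kf|revert Kg]; apply filter_imp; auto.
  - intros n; apply Derive_n_minus; [revert Hf|revert Hg]; apply filter_imp; auto.
Qed.

(** * Fifth derivatives read off from leading terms *)

Lemma continuous_locally_neq (G : R -> R) (x0 c : R) :
  continuous G x0 -> G x0 <> c -> locally x0 (fun x => G x <> c).
Proof.
  intros HC HN; apply (HC (fun y => y <> c)).
  apply (open_neq c); exact HN.
Qed.

(** Since [Y x = y' * (x - x0) + o(x - x0)] and [G x] tends to [G x0], division by [G] gives [D x =
    c * y'^5 / G x0 * (x - x0)^5 + o((x - x0)^5)]. *)
Lemma Derive_n_5_of_fifth_power (D G Y : R -> R) (x0 c y' : R) :
  smooth1_near D x0 -> continuous G x0 -> G x0 <> 0 ->
  is_derive Y x0 y' -> Y x0 = 0 ->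
  locally x0 (fun x => G x * D x = c * Y x ^ 5) ->
  Derive_n D 5 x0 = 120 * (c * y' ^ 5 / G x0).
Proof.
  intros HD HG HN HY HY0 HE.
  rewrite (taylor_unique D 5 x0
    (fun k => List.nth k (0 :: 0 :: 0 :: 0 :: 0 :: c * y' ^ 5 / G x0 :: nil) 0));
    [simpl; ring|exact HD| |lia].
  (* The quotient is rewritten as a combination of functions with known limits. The two forms agree
     at [x0] as well, where all numerators are 0. *)
  apply (limit1_in_ext_loc (fun x => c * (/ G x * ((Y x - Y x0) / (x - x0)) ^ 5)
    + - (c * y' ^ 5 / G x0) * ((x - x0) / (x - x0)))).
  - generalize (filter_and _ _ HE (continuous_locally_neq G x0 0 HG HN)).
    apply filter_imp; intros x [E N]; rewrite HY0.
    replace (D x) with (c * Y x ^ 5 / G x) by (rewrite <- E; now field).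
    simpl sum_f_R0; unfold List.nth.
    destruct (Req_dec x x0) as [->|Nx].
    + rewrite HY0, Rminus_diag; unfold Rdiv; simpl; ring.
    + field; repeat split; auto; lra.
  - replace 0 with (c * (/ G x0 * y' ^ 5) + - (c * y' ^ 5 / G x0) * 1) by (now field).
    apply limit_plus; apply limit_mul; try apply limit1_in_const.
    + apply limit_mul.
      * apply limit_inv; [now apply limit1_in_continuous|exact HN].
      * now apply limit1_in_pow, limit1_in_slope.
    + exact (limit1_in_slope (fun x => x) x0 1 (is_derive_id x0)).
Qed.

(** A fourth power reaches the fifth derivative only through the first-order variation of the
    factor: [1 / G x = 1 / G x0 - g' / G x0 ^ 2 * (x - x0) + o(x - x0)]. *)
Lemma Derive_n_5_of_fourth_power (D G : R -> R) (x0 c g' : R) :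
  smooth1_near D x0 -> is_derive G x0 g' -> G x0 <> 0 ->
  locally x0 (fun x => G x * D x = c * (x - x0) ^ 4) ->
  Derive_n D 5 x0 = - 120 * (c * g' / G x0 ^ 2).
Proof.
  intros HD HG HN HE.
  assert (HC := ex_derive_continuous G x0 (ex_intro _ _ HG)).
  rewrite (taylor_unique D 5 x0
    (fun k => List.nth k (0 :: 0 :: 0 :: 0 :: c / G x0 :: - (c * g' / G x0 ^ 2) :: nil) 0));
    [simpl; ring|exact HD| |lia].
  apply (limit1_in_ext_loc (fun x => - c / G x0 * (/ G x * ((G x - G x0) / (x - x0)))
    + c * g' / G x0 ^ 2 * ((x - x0) / (x - x0)))).
  - generalize (filter_and _ _ HE (continuous_locally_neq G x0 0 HC HN)).
    apply filter_imp; intros x [E N].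
    replace (D x) with (c * (x - x0) ^ 4 / G x) by (rewrite <- E; now field).
    simpl sum_f_R0; unfold List.nth.
    destruct (Req_dec x x0) as [->|Nx].
    + rewrite !Rminus_diag; unfold Rdiv; simpl; ring.
    + field; repeat split; auto; lra.
  - replace 0 with (- c / G x0 * (/ G x0 * g') + c * g' / G x0 ^ 2 * 1) by (now field).
    apply limit_plus; apply limit_mul; try apply limit1_in_const.
    + apply limit_mul.
      * apply limit_inv; [now apply limit1_in_continuous|exact HN].
      * now apply limit1_in_slope.
    + exact (limit1_in_slope (fun x => x) x0 1 (is_derive_id x0)).
Qed.

Lemma is_derive_minus_const (f : R -> R) (c x l : R) :
  is_derive f x l -> is_derive (fun y => f y - c) x l.
Proof.
  intros H; replace l with (l - 0) by ring.
  exact (is_derive_minus f (fun _ => c) x l 0 H (is_derive_const c x)).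
Qed.

(** The cofactor of [x - y] in [x^5 - y^5] is a sum of squares, whose vanishing forces
    [x * y = 0]. *)
Lemma pow5_inj (x y : R) : x ^ 5 = y ^ 5 -> x = y.
Proof.
  intros H.
  assert (E : (x - y) * ((x ^ 2 + x * y / 2) ^ 2 + (y ^ 2 + x * y / 2) ^ 2 + (x * y) ^ 2 / 2) = 0).
  { transitivity (x ^ 5 - y ^ 5); [field|lra]. }
  destruct (Rmult_integral _ _ E) as [K|K]; [lra|].
  pose proof (pow2_ge_0 (x ^ 2 + x * y / 2)); pose proof (pow2_ge_0 (y ^ 2 + x * y / 2)).
  pose proof (pow2_ge_0 (x * y)).
  assert (Z : x * y = 0) by (apply Rsqr_0_uniq; unfold Rsqr; simpl in *; lra).
  rewrite Z in *.
  destruct (Rmult_integral _ _ Z) as [-> | ->].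
  - destruct (Req_dec y 0) as [->|N]; [reflexivity|].
    apply (pow_nonzero y 5) in N; simpl in *; lra.
  - destruct (Req_dec x 0) as [->|N]; [reflexivity|].
    apply (pow_nonzero x 5) in N; simpl in *; lra.
Qed.

Lemma pow3_inj (x y : R) : x ^ 3 = y ^ 3 -> x = y.
Proof.
  intros H.
  assert (E : (x - y) * ((x + y / 2) ^ 2 + 3 / 4 * y ^ 2) = 0).
  { transitivity (x ^ 3 - y ^ 3); [field|lra]. }
  destruct (Rmult_integral _ _ E) as [K|K]; [lra|].
  pose proof (pow2_ge_0 (x + y / 2)); pose proof (pow2_ge_0 y).
  assert (Y : y = 0) by (apply Rsqr_0_uniq; unfold Rsqr; simpl in *; lra).
  subst y.
  destruct (Req_dec x 0) as [->|N]; [reflexivity|].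
  apply (pow_nonzero x 3) in N; simpl in *; lra.
Qed.

Lemma constant_of_zero_derive (f : R -> R) (c e : R) :
  (forall v, Rabs (v - c) < e -> is_derive f v 0) ->
  forall v, Rabs (v - c) < e -> f v = f c.
Proof.
  intros H v Hv.
  destruct (MVT_cor4 f (fun _ => 0) c (Rabs (v - c))) with (b := v) as (z & E & _).
  - intros w Hw; apply H; lra.
  - lra.
  - lra.
Qed.

(** * Polynomial test functions *)

(** The prescribed image solutions. At the centre [(t1, x1)] the value is [u1], the first
    derivatives are [p] and [q], and the fifth [xi]-derivative is [120 * r]; [s] and [m] belong to
    terms that the equation does not see there. *)
Definition test_fun (t1 x1 u1 p q m r s tau xi : R) : R :=
  u1 + p * (tau - t1) + s * (tau - t1) ^ 5
  + q * (xi - x1) + m * (xi - x1) ^ 4 + r * (xi - x1) ^ 5.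

(** One chain rule for all three partial derivatives of [g (T, X) - U]: [y], [z], [w] stand for
    slices of [T], [X], [U] in the same variable. *)
Lemma test_fun_is_derive (t1 x1 u1 p q m r s : R) (y z w : R -> R) (v y' z' w' : R) :
  is_derive y v y' -> is_derive z v z' -> is_derive w v w' ->
  is_derive (fun v => test_fun t1 x1 u1 p q m r s (y v) (z v) - w v) v
    ((p + 5 * s * (y v - t1) ^ 4) * y'
     + (q + 4 * m * (z v - x1) ^ 3 + 5 * r * (z v - x1) ^ 4) * z' - w').
Proof.
  intros Hy Hz Hw; unfold test_fun.
  auto_derive.
  - repeat split; eexists; eassumption.
  - replace (Derive (fun a : R => y a) v) with y' by (symmetry; now apply is_derive_unique).
    replace (Derive (fun a : R => z a) v) with z' by (symmetry; now apply is_derive_unique).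
    replace (Derive (fun a : R => w a) v) with w' by (symmetry; now apply is_derive_unique).
    ring.
Qed.

Definition full (t x u : R) : Prop := True.

Lemma open3_full : open3 full.
Proof. intros p _; apply filter_forall; exact (fun _ => I). Qed.

Lemma smooth3_n_coord (Om : R -> R -> R -> Prop) (n : nat) :
  smooth3_n Om n (fun t _ _ => t) /\ smooth3_n Om n (fun _ x _ => x) /\
  smooth3_n Om n (fun _ _ u => u).
Proof.
  assert (C : forall G c, (forall t x u, G t x u = c) -> forall n, smooth3_n Om n G).
  { intros G c E k.
    replace G with (fun _ _ _ : R => c); [apply smooth3_n_const|].
    repeat (apply FunctionalExtensionality.functional_extensionality; intro); symmetry; apply E. }
  destruct n as [|n].
  - repeat split; try exact I.
    + apply (continuous_comp fst fst); apply continuous_fst.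
    + apply (continuous_comp fst snd); [apply continuous_fst|apply continuous_snd].
    + apply continuous_snd.
  - split; [|split]; apply smooth3_n_S.
    + split; [|split].
      * intros; apply (continuous_comp fst fst); apply continuous_fst.
      * intros; split; [apply ex_derive_id|split; apply ex_derive_const].
      * split; [|split].
        -- apply (C _ 1); intros; unfold Dt, Dx, Du; apply Derive_id.
        -- apply (C _ 0); intros; unfold Dt, Dx, Du; apply Derive_const.
        -- apply (C _ 0); intros; unfold Dt, Dx, Du; apply Derive_const.
    + split; [|split].
      * intros; apply (continuous_comp fst snd); [apply continuous_fst|apply continuous_snd].
      * intros; split; [apply ex_derive_const|split; [apply ex_derive_id|apply ex_derive_const]].
      * split; [|split].
        -- apply (C _ 0); intros; unfold Dt, Dx, Du; apply Derive_const.
        -- apply (C _ 1); intros; unfold Dt, Dx, Du; apply Derive_id.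
        -- apply (C _ 0); intros; unfold Dt, Dx, Du; apply Derive_const.
    + split; [|split].
      * intros; apply continuous_snd.
      * intros; split; [apply ex_derive_const|split; [apply ex_derive_const|apply ex_derive_id]].
      * split; [|split].
        -- apply (C _ 0); intros; unfold Dt, Dx, Du; apply Derive_const.
        -- apply (C _ 0); intros; unfold Dt, Dx, Du; apply Derive_const.
        -- apply (C _ 1); intros; unfold Dt, Dx, Du; apply Derive_id.
Qed.

Section Smooth_polynomials.
Variable Om : R -> R -> R -> Prop.
Hypothesis HO : open3 Om.

Lemma smooth3_n_pow (n k : nat) (F : R -> R -> R -> R) :
  smooth3_n Om n F -> smooth3_n Om n (fun t x u => F t x u ^ k).
Proof.
  intros H; induction k as [|k IH]; [apply (smooth3_n_const Om n 1)|].
  now apply (smooth3_n_mult Om HO n F (fun t x u => F t x u ^ k)).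
Qed.

Lemma smooth3_n_minus (n : nat) (F G : R -> R -> R -> R) :
  smooth3_n Om n F -> smooth3_n Om n G -> smooth3_n Om n (fun t x u => F t x u - G t x u).
Proof.
  intros HF HG.
  apply (smooth3_n_ext Om HO n (fun t x u => F t x u + -1 * G t x u)); [intros; ring|].
  apply smooth3_n_plus; [exact HO|exact HF|].
  apply (smooth3_n_mult Om HO n (fun _ _ _ => -1)); [apply smooth3_n_const|exact HG].
Qed.

Lemma smooth3_n_test_fun (n : nat) (t1 x1 u1 p q m r s : R) (F G : R -> R -> R -> R) :
  smooth3_n Om n F -> smooth3_n Om n G ->
  smooth3_n Om n (fun t x u => test_fun t1 x1 u1 p q m r s (F t x u) (G t x u)).
Proof.
  intros HF HG; unfold test_fun.
  assert (K : forall c k d H, smooth3_n Om n H ->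
    smooth3_n Om n (fun t x u => c * (H t x u - d) ^ k)).
  { intros c k d H HH; apply (smooth3_n_mult Om HO n (fun _ _ _ => c)); [apply smooth3_n_const|].
    apply smooth3_n_pow; apply (smooth3_n_minus n H (fun _ _ _ => d)); [exact HH|].
    apply smooth3_n_const. }
  assert (K1 : forall c d H, smooth3_n Om n H ->
    smooth3_n Om n (fun t x u => c * (H t x u - d))).
  { intros c d H HH; apply (smooth3_n_mult Om HO n (fun _ _ _ => c)); [apply smooth3_n_const|].
    apply (smooth3_n_minus n H (fun _ _ _ => d)); [exact HH|].
    apply smooth3_n_const. }
  pose proof (smooth3_n_plus Om HO n) as P.
  exact (P _ _ (P _ _ (P _ _ (P _ _ (P _ _ (smooth3_n_const Om n u1) (K1 p t1 F HF))
    (K s 5%nat t1 F HF)) (K1 q x1 G HG)) (K m 4%nat x1 G HG)) (K r 5%nat x1 G HG)).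
Qed.

End Smooth_polynomials.

(** The calculus in three variables is reused: the zero function is the implicit function of
    [Phi = v], and the polynomial is a function on the whole space, constant in the third variable,
    evaluated along its graph. *)
Lemma smooth2_test_fun (t1 x1 u1 p q m r s t x : R) :
  smooth2_near (test_fun t1 x1 u1 p q m r s) t x.
Proof.
  apply locally_2d_forall; intros tau xi n.
  assert (D : forall a b v, Du (fun _ _ v => v) a b v = 1).
  { intros; apply Derive_id. }
  apply (ex_diff_n_graph full (fun _ _ v => v) (fun _ _ => 0) tau xi (mkposreal 1 Rlt_0_1)
    open3_full) with (H := fun tau xi _ => test_fun t1 x1 u1 p q m r s tau xi).
  - intros a b c K k; now apply (smooth3_n_coord full k).
  - intros a b _ _; rewrite D; repeat split; [lra|apply continuity_2d_pt_const].
  - apply (smooth3_n_subset full); [exact (fun _ _ _ _ => I)|].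
    apply (smooth3_n_test_fun full open3_full n _ _ _ _ _ _ _ _ (fun a _ _ => a) (fun _ b _ => b));
      apply smooth3_n_coord.
  - rewrite Rminus_diag, Rabs_R0; simpl; lra.
  - rewrite Rminus_diag, Rabs_R0; simpl; lra.
Qed.

Lemma test_fun_kdv (mu t1 x1 u1 p q m r s : R) :
  cc_kdv5 mu (test_fun t1 x1 u1 p q m r s) t1 x1 <-> p + u1 * q + mu * (120 * r) = 0.
Proof.
  assert (E1 : Derive (fun tau => test_fun t1 x1 u1 p q m r s tau x1) t1 = p).
  { apply is_derive_unique; unfold test_fun; auto_derive; [exact I|].
    simpl; ring. }
  assert (E2 : Derive (fun xi => test_fun t1 x1 u1 p q m r s t1 xi) x1 = q).
  { apply is_derive_unique; unfold test_fun; auto_derive; [exact I|].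
    simpl; ring. }
  assert (E3 : test_fun t1 x1 u1 p q m r s t1 x1 = u1).
  { unfold test_fun; rewrite !Rminus_diag; simpl; ring. }
  assert (E4 : Derive_n (fun xi => test_fun t1 x1 u1 p q m r s t1 xi) 5 x1 = 120 * r).
  { rewrite (taylor_unique _ 5 x1
      (fun k => List.nth k (u1 :: q :: 0 :: 0 :: m :: r :: nil) 0)).
    - simpl; ring.
    - apply smooth2_slice, smooth2_test_fun.
    - apply (limit1_in_ext_loc (fun _ => 0)); [|apply limit1_in_const].
      apply filter_forall; intros x; unfold test_fun; simpl; rewrite Rminus_diag; unfold Rdiv.
      match goal with |- 0 = ?A * _ => replace A with 0 by ring end; ring.
    - lia. }
  unfold cc_kdv5; rewrite E1, E2, E3, E4; split; lra.
Qed.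

(** * The shape of a reducing transformation *)

Section Reduction.
Variables (alpha beta : R -> R) (mu : R) (Om : R -> R -> R -> Prop) (T X U : R -> R -> R -> R).
Hypothesis Hmu : mu <> 0.
Hypothesis Hbeta : forall t x u, Om t x u -> beta t <> 0.
Hypothesis HTr : point_transformation Om T X U.
Hypothesis Hmaps : maps_equation Om T X U (vc_kdv5 alpha beta) (cc_kdv5 mu).

Let HO : open3 Om := proj1 HTr.
Let HT : forall n, smooth3_n Om n T.
Proof. exact (fun n t x u K => proj1 (proj2 HTr) t x u K n). Qed.
Let HX : forall n, smooth3_n Om n X.
Proof. exact (fun n t x u K => proj1 (proj2 (proj2 HTr)) t x u K n). Qed.
Let HU : forall n, smooth3_n Om n U.
Proof. exact (fun n t x u K => proj1 (proj2 (proj2 (proj2 HTr))) t x u K n). Qed.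

Let HJac : forall t x u, Om t x u -> jacobian T X U t x u <> 0 :=
  proj2 (proj2 (proj2 (proj2 HTr))).

Lemma smooth3_n_is_derive (F : R -> R -> R -> R) (t x u : R) :
  smooth3_n Om 1 F -> Om t x u ->
  is_derive (fun s => F s x u) t (Dt F t x u) /\ is_derive (fun y => F t y u) x (Dx F t x u) /\
  is_derive (fun v => F t x v) u (Du F t x u).
Proof.
  intros HF K; apply smooth3_n_S in HF; destruct HF as (_ & H & _).
  destruct (H t x u K) as (H1 & H2 & H3).
  repeat split; now apply Derive_correct.
Qed.

(** The derivative of [g (T, X) - U] at the base point when [g] has first derivatives [p] and [q] at
    the image point. The quotients [- lin Dt / lin Du] and [- lin Dx / lin Du] are the first
    derivatives of the preimage. *)
Definition lin (D : (R -> R -> R -> R) -> R -> R -> R -> R) (p q t x u : R) : R :=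
  p * D T t x u + q * D X t x u - D U t x u.

(** The function [g (T, X) - U] for the polynomial [g] centred at the image of the base point; the
    preimage of [g] is its zero set solved for [u]. *)
Definition defect (t0 x0 u0 p q m r s t x u : R) : R :=
  test_fun (T t0 x0 u0) (X t0 x0 u0) (U t0 x0 u0) p q m r s (T t x u) (X t x u) - U t x u.

Definition lin_defect (D : (R -> R -> R -> R) -> R -> R -> R -> R)
  (t0 x0 u0 p q m r s t x u : R) : R :=
  (p + 5 * s * (T t x u - T t0 x0 u0) ^ 4) * D T t x u
  + (q + 4 * m * (X t x u - X t0 x0 u0) ^ 3 + 5 * r * (X t x u - X t0 x0 u0) ^ 4) * D X t x u
  - D U t x u.

Lemma defect_is_derive (t0 x0 u0 p q m r s t x u : R) : Om t x u ->
  is_derive (fun z => defect t0 x0 u0 p q m r s z x u) t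
    (lin_defect Dt t0 x0 u0 p q m r s t x u) /\
  is_derive (fun z => defect t0 x0 u0 p q m r s t z u) x
    (lin_defect Dx t0 x0 u0 p q m r s t x u) /\
  is_derive (fun z => defect t0 x0 u0 p q m r s t x z) u
    (lin_defect Du t0 x0 u0 p q m r s t x u).
Proof.
  intros K.
  destruct (smooth3_n_is_derive T t x u (HT 1) K) as (T1 & T2 & T3).
  destruct (smooth3_n_is_derive X t x u (HX 1) K) as (X1 & X2 & X3).
  destruct (smooth3_n_is_derive U t x u (HU 1) K) as (U1 & U2 & U3).
  split; [|split].
  - exact (test_fun_is_derive _ _ _ p q m r s _ _ _ _ _ _ _ T1 X1 U1).
  - exact (test_fun_is_derive _ _ _ p q m r s _ _ _ _ _ _ _ T2 X2 U2).
  - exact (test_fun_is_derive _ _ _ p q m r s _ _ _ _ _ _ _ T3 X3 U3).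
Qed.

Lemma lin_defect_center (D : (R -> R -> R -> R) -> R -> R -> R -> R) (t0 x0 u0 p q m r s : R) :
  lin_defect D t0 x0 u0 p q m r s t0 x0 u0 = lin D p q t0 x0 u0.
Proof. unfold lin_defect, lin; rewrite !Rminus_diag; simpl; ring. Qed.

Lemma smooth3_n_defect (t0 x0 u0 p q m r s : R) (n : nat) :
  smooth3_n Om n (defect t0 x0 u0 p q m r s).
Proof.
  exact (smooth3_n_minus Om HO n _ _
    (smooth3_n_test_fun Om HO n (T t0 x0 u0) (X t0 x0 u0) (U t0 x0 u0) p q m r s T X (HT n) (HX n))
    (HU n)).
Qed.

(* [phi] is the slice at t = t0 of a solution of the variable coefficient equation through
   (t0, x0, u0) that is carried into the graph of [test_fun .. p q m r s]. *)
Definition slice_solution (t0 x0 u0 p q m r s : R) (phi : R -> R) : Prop :=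
  phi x0 = u0 /\ smooth1_near phi x0 /\
  locally x0 (fun x => defect t0 x0 u0 p q m r s t0 x (phi x) = 0) /\
  is_derive phi x0 (- (lin Dx p q t0 x0 u0 / lin Du p q t0 x0 u0)) /\
  - (lin Dt p q t0 x0 u0 / lin Du p q t0 x0 u0)
  + u0 * - (lin Dx p q t0 x0 u0 / lin Du p q t0 x0 u0)
  + alpha t0 * u0 + beta t0 * Derive_n phi 5 x0 = 0.

(** The implicit function theorem for [defect] produces a smooth [f] whose graph is carried into
    that of the polynomial. The last hypothesis is the target equation for the polynomial at the
    image point, and [maps_equation] pulls it back to the source equation for [f]. *)
Lemma slice_solution_exists (t0 x0 u0 p q m r s : R) :
  Om t0 x0 u0 -> lin Du p q t0 x0 u0 <> 0 ->
  p + U t0 x0 u0 * q + mu * (120 * r) = 0 ->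
  exists phi, slice_solution t0 x0 u0 p q m r s phi.
Proof.
  intros K HN HE.
  set (Phi := defect t0 x0 u0 p q m r s).
  destruct (defect_is_derive t0 x0 u0 p q m r s t0 x0 u0 K) as (P1 & P2 & P3).
  rewrite lin_defect_center in P1, P2, P3.
  assert (Q1 : Dt Phi t0 x0 u0 = lin Dt p q t0 x0 u0) by now apply is_derive_unique.
  assert (Q2 : Dx Phi t0 x0 u0 = lin Dx p q t0 x0 u0) by now apply is_derive_unique.
  assert (Q3 : Du Phi t0 x0 u0 = lin Du p q t0 x0 u0) by now apply is_derive_unique.
  pose proof (smooth3_n_defect t0 x0 u0 p q m r s) as HS; fold Phi in HS.
  assert (H0 : Phi t0 x0 u0 = 0).
  { unfold Phi, defect, test_fun; rewrite !Rminus_diag; simpl; ring. }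
  destruct (implicit_function Om Phi t0 x0 u0 HO (HS 1%nat) K H0) as (f & d & F0 & Hf).
  { now rewrite Q3. }
  assert (C : Rabs (t0 - t0) < d /\ Rabs (x0 - x0) < d).
  { rewrite !Rminus_diag, Rabs_R0; split; apply cond_pos. }
  destruct C as [C1 C2].
  assert (HSo : smooth3_on Om Phi) by (intros t x u L n; now apply HS).
  destruct (implicit_derivatives Om Phi f t0 x0 d HO HSo Hf t0 x0 C1 C2) as [D1 D2].
  rewrite F0, Q1, Q3 in D1; rewrite F0, Q2, Q3 in D2.
  assert (Hsm : smooth2_near f t0 x0).
  { exists d; intros t x Ht Hx n.
    apply (ex_diff_n_graph Om Phi f t0 x0 d HO HSo Hf n (fun _ _ u => u));
      [apply smooth3_n_coord|exact Ht|exact Hx]. }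
  assert (Hg : carries_graph T X U f
    (test_fun (T t0 x0 u0) (X t0 x0 u0) (U t0 x0 u0) p q m r s) t0 x0).
  { exists d; intros t x Ht Hx; destruct (Hf t x Ht Hx) as (_ & E & _).
    now apply Rminus_diag_uniq. }
  exists (fun x => f t0 x); split; [exact F0|]; split; [now apply smooth2_slice|].
  split; [|split; [exact D2|]].
  { exists d; intros x Hx; now apply Hf. }
  assert (E : vc_kdv5 alpha beta f t0 x0).
  { apply (Hmaps f (test_fun (T t0 x0 u0) (X t0 x0 u0) (U t0 x0 u0) p q m r s));
      rewrite ?F0; auto.
    - apply smooth2_test_fun.
    - apply test_fun_kdv; exact HE. }
  unfold vc_kdv5 in E.
  rewrite F0 in E.
  replace (Derive (fun s => f s x0) t0) with (- (lin Dt p q t0 x0 u0 / lin Du p q t0 x0 u0)) in E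
    by (symmetry; now apply is_derive_unique).
  replace (Derive (fun y => f t0 y) x0) with (- (lin Dx p q t0 x0 u0 / lin Du p q t0 x0 u0)) in E
    by (symmetry; now apply is_derive_unique).
  exact E.
Qed.

(** The mean value theorem in [u] for the first [defect] between [phi x] and [phi' x]; [G] is its
    [u]-derivative at the intermediate point. The common slope [l] is what makes [G] differentiable
    at [x0]. *)
Lemma slice_difference (t0 x0 u0 p q m r s p' q' m' r' s' l : R) (phi phi' : R -> R) :
  Om t0 x0 u0 ->
  slice_solution t0 x0 u0 p q m r s phi -> slice_solution t0 x0 u0 p' q' m' r' s' phi' ->
  is_derive phi x0 l -> is_derive phi' x0 l ->
  exists G : R -> R, G x0 = lin Du p q t0 x0 u0 /\
    is_derive G x0 (Dx (Du (defect t0 x0 u0 p q m r s)) t0 x0 u0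
                    + Du (Du (defect t0 x0 u0 p q m r s)) t0 x0 u0 * l) /\
    locally x0 (fun x => G x * (phi' x - phi x) =
      test_fun 0 0 0 (p - p') (q - q') (m - m') (r - r') (s - s')
        (T t0 x (phi' x) - T t0 x0 u0) (X t0 x (phi' x) - X t0 x0 u0)).
Proof.
  intros K (A1 & _ & A3 & _) (B1 & _ & B3 & _) A4 B4.
  destruct (open3_box Om t0 x0 u0 HO K) as [e He].
  assert (Ca := ex_derive_continuous phi x0 (ex_intro _ _ A4)).
  assert (Cb := ex_derive_continuous phi' x0 (ex_intro _ _ B4)).
  pose proof (proj1 (filterlim_locally _ _) Ca e) as La.
  pose proof (proj1 (filterlim_locally _ _) Cb e) as Lb.
  (* [z] is a mean value point. The first defect vanishes at [phi x] and the second at [phi' x], so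
     the increment of the first is the difference of the two at [phi' x], where [U] cancels and only
     differences of coefficients remain. *)
  set (P := fun x z => Rmin (phi x) (phi' x) <= z <= Rmax (phi x) (phi' x) /\
    lin_defect Du t0 x0 u0 p q m r s t0 x z * (phi' x - phi x) =
      test_fun 0 0 0 (p - p') (q - q') (m - m') (r - r') (s - s')
        (T t0 x (phi' x) - T t0 x0 u0) (X t0 x (phi' x) - X t0 x0 u0)).
  assert (HP : locally x0 (fun x => P x (epsilon (inhabits 0) (P x)))).
  { assert (L0 : locally x0 (fun x => Rabs (x - x0) < e)) by (exists e; auto).
    generalize (filter_and _ _ L0 (filter_and _ _ (filter_and _ _ La Lb) (filter_and _ _ A3 B3))).
    apply filter_imp; intros x (H0 & (Ha & Hb) & (Ea & Eb)).
    apply (epsilon_spec (inhabits 0) (P x)).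
    change (Rabs (phi x - phi x0) < e) in Ha; change (Rabs (phi' x - phi' x0) < e) in Hb.
    rewrite A1 in Ha; rewrite B1 in Hb.
    assert (HI : forall v, Rmin (phi x) (phi' x) <= v <= Rmax (phi x) (phi' x) -> Om t0 x v).
    { intros v Hv; apply He; repeat split; [rewrite Rminus_diag, Rabs_R0; apply cond_pos|exact H0|].
      apply Rabs_def2 in Ha, Hb; apply Rabs_def1.
      - destruct Hv as [_ Hv]; eapply Rle_lt_trans; [apply Rplus_le_compat_r, Hv|].
        unfold Rmax; destruct (Rle_dec (phi x) (phi' x)); lra.
      - destruct Hv as [Hv _]; eapply Rlt_le_trans; [|apply Rplus_le_compat_r, Hv].
        unfold Rmin; destruct (Rle_dec (phi x) (phi' x)); lra. }
    destruct (MVT_gen (fun v => defect t0 x0 u0 p q m r s t0 x v) (phi x) (phi' x)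
       (fun v => lin_defect Du t0 x0 u0 p q m r s t0 x v)) as [z [Hz Ez]].
    - intros v Hv; apply defect_is_derive, HI; lra.
    - intros v Hv; apply derivable_continuous_pt, ex_derive_Reals_0.
      eexists; apply defect_is_derive, HI, Hv.
    - exists z; split; [exact Hz|].
      rewrite <- Ez, Ea; unfold defect, test_fun in Eb |- *.
      match type of Eb with ?y = 0 => match goal with |- ?l = ?h =>
        transitivity (l - y); [rewrite Eb; ring|ring] end end. }
  set (z := fun x => epsilon (inhabits 0) (P x)) in HP.
  (* The points [z x] are arbitrary choices; their derivative comes from the two bounds, which share
     value and slope at [x0]. *)
  assert (Hz : is_derive z x0 l).
  { apply (is_derive_squeeze phi phi' z x0 l A4 B4); [congruence|].
    revert HP; apply filter_imp; intros x [H _]; exact H. }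
  assert (Ez : z x0 = u0).
  { pose proof (locally_singleton _ _ HP) as [H _].
    rewrite A1, B1, Rmin_left, Rmax_left in H by lra; unfold z; lra. }
  destruct (proj1 (smooth3_n_S Om 1 _) (smooth3_n_defect t0 x0 u0 p q m r s 2))
    as (_ & _ & _ & _ & S).
  exists (fun x => Du (defect t0 x0 u0 p q m r s) t0 x (z x)); split; [|split].
  - rewrite Ez, <- (lin_defect_center Du t0 x0 u0 p q m r s).
    apply is_derive_unique, defect_is_derive, K.
  - pose proof (proj2 (smooth3_is_derive_graph Om _ t0 x0 z l HO S)) as Q.
    rewrite Ez in Q; exact (Q K Hz).
  - assert (Cz := ex_derive_continuous z x0 (ex_intro _ _ Hz)).
    pose proof (proj1 (filterlim_locally _ _) Cz e) as Lz.
    assert (L0 : locally x0 (fun x => Rabs (x - x0) < e)) by (exists e; auto).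
    generalize (filter_and _ _ HP (filter_and _ _ L0 Lz)).
    apply filter_imp; intros x ((_ & E) & H0 & H1).
    change (Rabs (z x - z x0) < e) in H1; rewrite Ez in H1.
    rewrite <- E; f_equal; apply is_derive_unique, defect_is_derive, He.
    repeat split; [rewrite Rminus_diag, Rabs_R0; apply cond_pos|exact H0|exact H1].
Qed.

(** Nondegeneracy excludes [T_u = X_u = U_u = 0], and a suitable choice of coefficients makes
    [lin Du] nonzero. Two values of [q] are provided because the identities obtained for each
    admissible [q] are then compared. *)
Lemma lin_transversal (t x u : R) : Om t x u ->
  exists p q1 q2, q1 <> q2 /\ lin Du p q1 t x u <> 0 /\ lin Du p q2 t x u <> 0.
Proof.
  intros K; pose proof (HJac t x u K) as HJ.
  unfold lin.
  destruct (Req_dec (Du X t x u) 0) as [X0|X0].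
  - rewrite X0; destruct (Req_dec (Du T t x u) 0) as [T0|T0].
    + exists 0, 0, 1; split; [lra|].
      assert (Du U t x u <> 0).
      { intros U0; apply HJ; unfold jacobian; rewrite X0, T0, U0; ring. }
      split; lra.
    + exists ((Du U t x u + 1) / Du T t x u), 0, 1; split; [lra|].
      replace ((Du U t x u + 1) / Du T t x u * Du T t x u) with (Du U t x u + 1) by now field.
      split; lra.
  - exists 0, ((Du U t x u + 1) / Du X t x u), ((Du U t x u + 2) / Du X t x u).
    replace ((Du U t x u + 1) / Du X t x u * Du X t x u) with (Du U t x u + 1) by now field.
    replace ((Du U t x u + 2) / Du X t x u * Du X t x u) with (Du U t x u + 2) by now field.
    split; [|split; lra].
    intros E; apply (f_equal (fun y => y * Du X t x u)) in E.
    field_simplify in E; lra.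
Qed.

(** * The time component depends on [t] only *)

(** The images with [s = 0] and [s = 1] both satisfy the target equation, and their preimages have
    the same value and first derivatives. The source equation with nonzero [beta] then equates the
    fifth derivatives, while their difference is a nonzero multiple of the fifth power of the left
    side. *)
Lemma time_slope_zero (t0 x0 u0 p q : R) : Om t0 x0 u0 -> lin Du p q t0 x0 u0 <> 0 ->
  Dx T t0 x0 u0 + Du T t0 x0 u0 * - (lin Dx p q t0 x0 u0 / lin Du p q t0 x0 u0) = 0.
Proof.
  intros K HN.
  (* The free coefficient [r] solves the target equation for any given [p] and [q]. *)
  set (r := - (p + U t0 x0 u0 * q) / (120 * mu)).
  assert (Hr : p + U t0 x0 u0 * q + mu * (120 * r) = 0) by (unfold r; now field).
  destruct (slice_solution_exists t0 x0 u0 p q 0 r 0 K HN Hr) as [phi S1].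
  destruct (slice_solution_exists t0 x0 u0 p q 0 r 1 K HN Hr) as [phi' S2].
  set (l := - (lin Dx p q t0 x0 u0 / lin Du p q t0 x0 u0)).
  pose proof S1 as (A1 & A2 & _ & A4 & A5).
  pose proof S2 as (B1 & B2 & _ & B4 & B5).
  destruct (slice_difference t0 x0 u0 _ _ _ _ _ _ _ _ _ _ l phi phi' K S1 S2 A4 B4)
    as (G & G0 & GD & GE).
  destruct (smooth1_near_minus phi' phi x0 B2 A2) as [DS DD].
  set (y' := Dx T t0 x0 u0 + Du T t0 x0 u0 * l).
  assert (HY : is_derive (fun x => T t0 x (phi' x) - T t0 x0 u0) x0 y').
  { apply is_derive_minus_const.
    pose proof (proj2 (smooth3_is_derive_graph Om _ t0 x0 phi' l HO (HT 1))) as Q.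
    rewrite B1 in Q; exact (Q K B4). }
  assert (E : Derive_n (fun x => phi' x - phi x) 5 x0 = 120 * (-1 * y' ^ 5 / G x0)).
  { apply (Derive_n_5_of_fifth_power _ G (fun x => T t0 x (phi' x) - T t0 x0 u0)); auto.
    - exact (ex_derive_continuous G x0 (ex_intro _ _ GD)).
    - now rewrite G0.
    - rewrite B1; ring.
    - revert GE; apply filter_imp; intros x ->; unfold test_fun; ring. }
  rewrite DD, G0 in E.
  assert (E2 : beta t0 * (Derive_n phi' 5 x0 - Derive_n phi 5 x0) = 0) by lra.
  rewrite E in E2.
  destruct (Rmult_integral _ _ E2) as [E3|E3]; [exact (False_ind _ (Hbeta t0 x0 u0 K E3))|].
  destruct (Req_dec y' 0) as [Y|Y]; [exact Y|exfalso].
  apply (pow_nonzero y' 5) in Y; apply Y.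
  apply (f_equal (fun v => v * lin Du p q t0 x0 u0)) in E3.
  field_simplify in E3; lra.
Qed.

(** Cleared of denominators, [time_slope_zero] reads [q * (T_x X_u - T_u X_x) - (T_x U_u - T_u U_x)
    = 0], and two values of [q] kill both minors. Expanded along the [t]-derivatives, the Jacobian
    reduces to [T_t * (X_x U_u - X_u U_x)]; since this minor is nonzero, the two vanishing ones
    force [T_x = T_u = 0]. *)
Lemma time_only (t x u : R) : Om t x u ->
  Dx T t x u = 0 /\ Du T t x u = 0 /\ Dt T t x u <> 0 /\
  Dx X t x u * Du U t x u - Du X t x u * Dx U t x u <> 0.
Proof.
  intros K; destruct (lin_transversal t x u K) as (p & q1 & q2 & Hq & N1 & N2).
  pose proof (time_slope_zero t x u p q1 K N1) as E1.
  pose proof (time_slope_zero t x u p q2 K N2) as E2.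
  pose proof (HJac t x u K) as HJ; unfold jacobian in HJ.
  apply (f_equal (fun v => v * lin Du p q1 t x u)) in E1.
  apply (f_equal (fun v => v * lin Du p q2 t x u)) in E2.
  field_simplify in E1; [|exact N1]; field_simplify in E2; [|exact N2].
  unfold lin in E1, E2, N1, N2.
  set (Tt := Dt T t x u) in *; set (Tx := Dx T t x u) in *; set (Tu := Du T t x u) in *.
  set (Xt := Dt X t x u) in *; set (Xx := Dx X t x u) in *; set (Xu := Du X t x u) in *.
  set (Ut := Dt U t x u) in *; set (Ux := Dx U t x u) in *; set (Uu := Du U t x u) in *.
  assert (A : (q1 - q2) * (Tx * Xu - Tu * Xx) = 0) by lra.
  destruct (Rmult_integral _ _ A) as [A'|A']; [lra|].
  assert (B : Tx * Uu - Tu * Ux = 0).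
  { replace (Tx * Uu - Tu * Ux) with (q1 * (Tx * Xu - Tu * Xx)
      - (Tx * (p * Tu + q1 * Xu - Uu) - Tu * (p * Tx + q1 * Xx - Ux))) by ring.
    rewrite A'; lra. }
  assert (J : Xx * Uu - Xu * Ux <> 0).
  { intros J; apply HJ; rewrite J.
    replace (- Tx * (Xt * Uu - Xu * Ut) + Tu * (Xt * Ux - Xx * Ut))
      with (- Xt * (Tx * Uu - Tu * Ux) + Ut * (Tx * Xu - Tu * Xx)) by ring.
    transitivity (- Xt * (Tx * Uu - Tu * Ux) + Ut * (Tx * Xu - Tu * Xx)); [ring|].
    rewrite A', B; ring. }
  assert (X0 : Tx = 0).
  { apply (Rmult_eq_reg_r (Xx * Uu - Xu * Ux)); [|exact J].
    transitivity (Xx * (Tx * Uu - Tu * Ux) - Ux * (Tx * Xu - Tu * Xx)); [ring|].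
    rewrite A', B; ring. }
  assert (U0 : Tu = 0).
  { apply (Rmult_eq_reg_r (Xx * Uu - Xu * Ux)); [|exact J].
    transitivity (Xu * (Tx * Uu - Tu * Ux) - Uu * (Tx * Xu - Tu * Xx)); [ring|].
    rewrite A', B; ring. }
  repeat split; auto.
  intros T0; apply HJ; rewrite T0, X0, U0; ring.
Qed.

(** The vanishing derivatives are integrated on a box only, since slices of [Om] need not be
    connected. *)
Lemma time_local (t0 x0 u0 : R) : Om t0 x0 u0 ->
  exists e : posreal, forall t x u, box e t0 x0 u0 t x u ->
    Om t x u /\ T t x u = T t x0 u0 /\ Dt T t x u = Dt T t x0 u0.
Proof.
  intros K; destruct (open3_box Om t0 x0 u0 HO K) as [e He].
  assert (ET : forall t x u, box e t0 x0 u0 t x u -> T t x u = T t x0 u0).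
  { intros t x u (B1 & B2 & B3).
    transitivity (T t x u0).
    - apply (constant_of_zero_derive (fun v => T t x v) u0 e); [|exact B3].
      intros v Hv.
      assert (L : Om t x v) by (apply He; repeat split; assumption).
      destruct (time_only t x v L) as (_ & E & _); rewrite <- E.
      now apply smooth3_n_is_derive.
    - apply (constant_of_zero_derive (fun v => T t v u0) x0 e); [|exact B2].
      intros v Hv.
      assert (L : Om t v u0)
        by (apply He; repeat split; try assumption; rewrite Rminus_diag, Rabs_R0; apply cond_pos).
      destruct (time_only t v u0 L) as (E & _); rewrite <- E.
      now apply smooth3_n_is_derive. }
  exists e; intros t x u B; split; [now apply He|split; [now apply ET|]].
  destruct B as (B1 & B2 & B3).
  apply Derive_ext_loc.
  assert (P : 0 < e - Rabs (t - t0)) by lra.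
  exists (mkposreal _ P); intros s Hs; change (Rabs (s - t) < e - Rabs (t - t0)) in Hs.
  apply ET; repeat split; auto.
  replace (s - t0) with ((s - t) + (t - t0)) by ring.
  eapply Rle_lt_trans; [apply Rabs_triang|]; lra.
Qed.

Lemma locally_graph_box (e : posreal) (t0 x0 u0 l : R) (phi : R -> R) :
  phi x0 = u0 -> is_derive phi x0 l ->
  locally x0 (fun x => box e t0 x0 u0 t0 x (phi x)).
Proof.
  intros E D.
  pose proof (proj1 (filterlim_locally _ _) (ex_derive_continuous phi x0 (ex_intro _ _ D)) e) as L.
  assert (L0 : locally x0 (fun x => Rabs (x - x0) < e)) by (exists e; auto).
  generalize (filter_and _ _ L0 L); apply filter_imp; intros x [H1 H2].
  change (Rabs (phi x - phi x0) < e) in H2; rewrite E in H2.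
  repeat split; [rewrite Rminus_diag, Rabs_R0; apply cond_pos|exact H1|exact H2].
Qed.

(** * The space component is affine in [x] *)

(** Raising [r] from 0 to 1 while lowering [p] by [120 * mu] preserves the target equation. As
    [T_x = T_u = 0], the change of [p] leaves the slope of the preimage alone and adds
    [120 * mu * T_t / lin Du] to its [t]-derivative, which [beta] times the change of the fifth
    derivative must compensate. The minor on the right is, up to sign, [lin Du] times the total
    [x]-derivative of [X]. *)
Lemma fifth_power_balance (t0 x0 u0 q : R) : Om t0 x0 u0 -> lin Du 0 q t0 x0 u0 <> 0 ->
  mu * Dt T t0 x0 u0 * lin Du 0 q t0 x0 u0 ^ 5 =
  - beta t0 * (Dx X t0 x0 u0 * Du U t0 x0 u0 - Du X t0 x0 u0 * Dx U t0 x0 u0) ^ 5.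
Proof.
  intros K HN; destruct (time_only t0 x0 u0 K) as (Tx & Tu & _).
  assert (Lu : forall p, lin Du p q t0 x0 u0 = lin Du 0 q t0 x0 u0)
    by (intros; unfold lin; rewrite Tu; ring).
  assert (Lx : forall p, lin Dx p q t0 x0 u0 = lin Dx 0 q t0 x0 u0)
    by (intros; unfold lin; rewrite Tx; ring).
  set (p := - (U t0 x0 u0 * q)); set (p' := p - 120 * mu).
  destruct (slice_solution_exists t0 x0 u0 p q 0 0 0 K) as [phi S1];
    [now rewrite Lu|unfold p; ring|].
  destruct (slice_solution_exists t0 x0 u0 p' q 0 1 0 K) as [phi' S2];
    [now rewrite Lu|unfold p', p; ring|].
  pose proof S1 as (A1 & A2 & _ & A4 & A5).
  pose proof S2 as (B1 & B2 & _ & B4 & B5).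
  rewrite Lx, Lu in A4, A5, B4, B5.
  set (k := lin Du 0 q t0 x0 u0) in *; set (l := - (lin Dx 0 q t0 x0 u0 / k)) in *.
  destruct (slice_difference t0 x0 u0 _ _ _ _ _ _ _ _ _ _ l phi phi' K S1 S2 A4 B4)
    as (G & G0 & GD & GE).
  rewrite Lu in G0; fold k in G0.
  destruct (smooth1_near_minus phi' phi x0 B2 A2) as [DS DD].
  set (y' := Dx X t0 x0 u0 + Du X t0 x0 u0 * l).
  assert (HY : is_derive (fun x => X t0 x (phi' x) - X t0 x0 u0) x0 y').
  { apply is_derive_minus_const.
    pose proof (proj2 (smooth3_is_derive_graph Om _ t0 x0 phi' l HO (HX 1))) as Q.
    rewrite B1 in Q; exact (Q K B4). }
  (* On the slice [t = t0] the increment of [T] vanishes near the point, so the term with [p - p']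
     drops out of the difference. *)
  destruct (time_local t0 x0 u0 K) as [e He].
  assert (E : Derive_n (fun x => phi' x - phi x) 5 x0 = 120 * (-1 * y' ^ 5 / G x0)).
  { apply (Derive_n_5_of_fifth_power _ G (fun x => X t0 x (phi' x) - X t0 x0 u0)); auto.
    - exact (ex_derive_continuous G x0 (ex_intro _ _ GD)).
    - now rewrite G0.
    - rewrite B1; ring.
    - generalize (filter_and _ _ GE (locally_graph_box e t0 x0 u0 l phi' B1 B4)).
      apply filter_imp; intros x [-> B].
      destruct (He _ _ _ B) as (_ & -> & _); unfold test_fun; ring. }
  rewrite DD, G0 in E.
  assert (Y : y' * k = - (Dx X t0 x0 u0 * Du U t0 x0 u0 - Du X t0 x0 u0 * Dx U t0 x0 u0)).
  { unfold y', l; field_simplify; [|exact HN]; unfold k, lin; rewrite Tx, Tu; ring. }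
  assert (F : lin Dt p' q t0 x0 u0 = lin Dt p q t0 x0 u0 - 120 * mu * Dt T t0 x0 u0)
    by (unfold lin, p'; ring).
  rewrite F in B5.
  assert (E2 : 120 * mu * Dt T t0 x0 u0 / k
     + beta t0 * (Derive_n phi' 5 x0 - Derive_n phi 5 x0) = 0).
  { replace (- ((lin Dt p q t0 x0 u0 - 120 * mu * Dt T t0 x0 u0) / k))
      with (- (lin Dt p q t0 x0 u0 / k) + 120 * mu * Dt T t0 x0 u0 / k) in B5 by (now field).
    lra. }
  rewrite E in E2.
  assert (E3 : mu * Dt T t0 x0 u0 = beta t0 * y' ^ 5).
  { apply (f_equal (fun v => v * k / 120)) in E2; field_simplify in E2; [|exact HN]. lra. }
  replace ((Dx X t0 x0 u0 * Du U t0 x0 u0 - Du X t0 x0 u0 * Dx U t0 x0 u0)) with (- (y' * k))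
    by lra.
  rewrite E3; ring.
Qed.

(** The right side of [fifth_power_balance] does not contain [q]. As [mu * T_t] is nonzero and fifth
    powers are injective, [lin Du 0 q = q * X_u - U_u] takes the same value for two different [q],
    so [X_u = 0]; substituting back gives the rest. *)
Lemma space_affine (t x u : R) : Om t x u ->
  Du X t x u = 0 /\ mu * Dt T t x u = beta t * Dx X t x u ^ 5 /\ Dx X t x u <> 0 /\
  Du U t x u <> 0.
Proof.
  intros K; destruct (time_only t x u K) as (Tx & Tu & Tt & J).
  destruct (lin_transversal t x u K) as (p & q1 & q2 & Hq & N1 & N2).
  assert (Lu : forall p q, lin Du p q t x u = lin Du 0 q t x u)
    by (intros; unfold lin; rewrite Tu; ring).
  rewrite Lu in N1, N2.
  pose proof (fifth_power_balance t x u q1 K N1) as E1.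
  pose proof (fifth_power_balance t x u q2 K N2) as E2.
  assert (X0 : Du X t x u = 0).
  { assert (E : lin Du 0 q1 t x u = lin Du 0 q2 t x u).
    { apply pow5_inj, (Rmult_eq_reg_l (mu * Dt T t x u)); [now rewrite E1, E2|].
      now apply Rmult_integral_contrapositive_currified. }
    unfold lin in E; apply (Rmult_eq_reg_l (q1 - q2)); [lra|lra]. }
  rewrite X0 in J, E1.
  assert (U0 : Du U t x u <> 0) by (intros E; apply J; rewrite E; ring).
  split; [exact X0|]; split; [|split; [|exact U0]].
  - apply (Rmult_eq_reg_r (- Du U t x u ^ 5)).
    + transitivity (mu * Dt T t x u * lin Du 0 q1 t x u ^ 5);
        [unfold lin; rewrite X0; ring|rewrite E1; ring].
    + apply Ropp_neq_0_compat, pow_nonzero, U0.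
  - intros E; apply J; rewrite E; ring.
Qed.

(** By [mu * T_t = beta * X_x^5], [X_x] is a real fifth root of a function of [t], hence locally
    itself a function of [t]. *)
Lemma space_local (t0 x0 u0 : R) : Om t0 x0 u0 ->
  exists e : posreal, forall t x u, box e t0 x0 u0 t x u ->
    Om t x u /\ T t x u = T t x0 u0 /\ Dt T t x u = Dt T t x0 u0 /\
    Dx X t x u = Dx X t x0 u0 /\ X t x u = X t x0 u0 + Dx X t x0 u0 * (x - x0).
Proof.
  intros K; destruct (time_local t0 x0 u0 K) as [e He]; exists e.
  assert (P0 : Rabs (x0 - x0) < e /\ Rabs (u0 - u0) < e)
    by (rewrite !Rminus_diag, Rabs_R0; split; apply cond_pos).
  intros t x u B; destruct (He t x u B) as (L & E1 & E2).
  assert (EX : forall y v, box e t0 x0 u0 t y v -> Dx X t y v = Dx X t x0 u0).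
  { intros y v By.
    assert (Bc : box e t0 x0 u0 t x0 u0) by (destruct B; repeat split; tauto).
    destruct (He _ _ _ By) as (My & _ & Ty); destruct (He _ _ _ Bc) as (Mc & _ & _).
    apply pow5_inj, (Rmult_eq_reg_l (beta t)); [|exact (Hbeta _ _ _ My)].
    rewrite <- (proj1 (proj2 (space_affine _ _ _ My))),
      <- (proj1 (proj2 (space_affine _ _ _ Mc))), Ty; reflexivity. }
  split; [exact L|split; [exact E1|split; [exact E2|split; [now apply EX|]]]].
  destruct B as (B1 & B2 & B3).
  transitivity (X t x u0).
  - apply (constant_of_zero_derive (fun v => X t x v) u0 e); [|exact B3].
    intros v Hv.
    assert (M : Om t x v) by (apply He; repeat split; assumption).
    destruct (space_affine t x v M) as (E & _); rewrite <- E.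
    now apply smooth3_n_is_derive.
  - enough (E : X t x u0 - Dx X t x0 u0 * (x - x0) = X t x0 u0 - Dx X t x0 u0 * (x0 - x0)) by lra.
    apply (constant_of_zero_derive (fun y => X t y u0 - Dx X t x0 u0 * (y - x0)) x0 e);
      [|exact B2].
    intros y Hy.
    assert (By : box e t0 x0 u0 t y u0) by (repeat split; tauto).
    destruct (He _ _ _ By) as (My & _ & _).
    assert (HD : is_derive (fun y => X t y u0) y (Dx X t x0 u0)).
    { rewrite <- (EX y u0 By); now apply smooth3_n_is_derive. }
    auto_derive; [eexists; exact HD|].
    replace (Derive (fun y => X t y u0) y) with (Dx X t x0 u0)
      by (symmetry; now apply is_derive_unique).
    ring.
Qed.

(** * The coefficient of [u] in the dependent component *)

(** The images with [m = 0] and [m = 1] satisfy the target equation, and the first derivatives of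
    their preimages agree, so the fifth derivatives agree too. As [X] is exactly affine, the
    preimages differ by [- X_x^4 * (x - x0)^4 / G], where [G] is [- U_u] along a curve with the
    slope of the preimage. The fifth derivative of this difference detects the slope of [G], which
    is up to sign the left side. *)
Lemma dependent_balance (t0 x0 u0 q : R) : Om t0 x0 u0 ->
  Dx (Du U) t0 x0 u0
  + Du (Du U) t0 x0 u0 * ((q * Dx X t0 x0 u0 - Dx U t0 x0 u0) / Du U t0 x0 u0) = 0.
Proof.
  intros K; destruct (time_only t0 x0 u0 K) as (Tx & Tu & _).
  destruct (space_affine t0 x0 u0 K) as (Xu & _ & Xx & Uu).
  set (p := - (U t0 x0 u0 * q)).
  assert (Lu : lin Du p q t0 x0 u0 = - Du U t0 x0 u0) by (unfold lin; rewrite Tu, Xu; ring).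
  assert (HN : lin Du p q t0 x0 u0 <> 0) by (rewrite Lu; lra).
  destruct (slice_solution_exists t0 x0 u0 p q 0 0 0 K HN) as [phi S1]; [unfold p; ring|].
  destruct (slice_solution_exists t0 x0 u0 p q 1 0 0 K HN) as [phi' S2]; [unfold p; ring|].
  pose proof S1 as (A1 & A2 & _ & A4 & A5).
  pose proof S2 as (B1 & B2 & _ & B4 & B5).
  set (l := - (lin Dx p q t0 x0 u0 / lin Du p q t0 x0 u0)) in *.
  destruct (slice_difference t0 x0 u0 _ _ _ _ _ _ _ _ _ _ l phi phi' K S1 S2 A4 B4)
    as (G & G0 & GD & GE).
  destruct (smooth1_near_minus phi' phi x0 B2 A2) as [DS DD].
  destruct (space_local t0 x0 u0 K) as [e He].
  assert (ED : forall t x u, Om t x u ->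
    Du (defect t0 x0 u0 p q 0 0 0) t x u = - Du U t x u).
  { intros t x u M; transitivity (lin_defect Du t0 x0 u0 p q 0 0 0 t x u).
    - now apply is_derive_unique, defect_is_derive.
    - unfold lin_defect; rewrite (proj1 (proj2 (time_only t x u M))),
        (proj1 (space_affine t x u M)); ring. }
  destruct (open3_slices Om t0 x0 u0 HO K) as (_ & L2 & L3).
  assert (D1 : Dx (Du (defect t0 x0 u0 p q 0 0 0)) t0 x0 u0 = - Dx (Du U) t0 x0 u0).
  { unfold Dx at 1; rewrite (Derive_ext_loc _ (fun y => - Du U t0 y u0)).
    - apply Derive_opp.
    - revert L2; apply filter_imp; intros y; apply ED. }
  assert (D2 : Du (Du (defect t0 x0 u0 p q 0 0 0)) t0 x0 u0 = - Du (Du U) t0 x0 u0).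
  { unfold Du at 1; rewrite (Derive_ext_loc _ (fun v => - Du U t0 x0 v)).
    - apply Derive_opp.
    - revert L3; apply filter_imp; intros v; apply ED. }
  rewrite D1, D2 in GD.
  assert (E : Derive_n (fun x => phi' x - phi x) 5 x0 =
    - 120 * (- Dx X t0 x0 u0 ^ 4 * (- Dx (Du U) t0 x0 u0 + - Du (Du U) t0 x0 u0 * l) / G x0 ^ 2)).
  { apply (Derive_n_5_of_fourth_power _ G); auto.
    - now rewrite G0.
    - generalize (filter_and _ _ GE (locally_graph_box e t0 x0 u0 l phi' B1 B4)).
      apply filter_imp; intros x [-> B].
      destruct (He _ _ _ B) as (_ & _ & _ & _ & ->); unfold test_fun; ring. }
  rewrite DD, G0 in E.
  assert (E2 : beta t0 * (Derive_n phi' 5 x0 - Derive_n phi 5 x0) = 0) by lra.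
  rewrite E in E2.
  destruct (Rmult_integral _ _ E2) as [E3|E3]; [exact (False_ind _ (Hbeta t0 x0 u0 K E3))|].
  replace ((q * Dx X t0 x0 u0 - Dx U t0 x0 u0) / Du U t0 x0 u0) with l.
  2: { unfold l; rewrite Lu; unfold lin; rewrite Tx; field; exact Uu. }
  rewrite Lu in E3.
  apply (Rmult_eq_reg_l (Dx X t0 x0 u0 ^ 4)); [|now apply pow_nonzero].
  match type of E3 with ?y = 0 =>
    transitivity (y * - (Du U t0 x0 u0 ^ 2 / 120)); [now field|rewrite E3; ring] end.
Qed.

(** The two values of [q] are those that give the preimage the slopes 0 and 1. *)
Lemma dependent_affine (t x u : R) : Om t x u -> Dx (Du U) t x u = 0 /\ Du (Du U) t x u = 0.
Proof.
  intros K; destruct (space_affine t x u K) as (Xu & _ & Xx & Uu).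
  pose proof (dependent_balance t x u (Dx U t x u / Dx X t x u) K) as E1.
  pose proof (dependent_balance t x u ((Dx U t x u + Du U t x u) / Dx X t x u) K) as E2.
  replace ((Dx U t x u / Dx X t x u * Dx X t x u - Dx U t x u) / Du U t x u) with 0 in E1
    by (field; auto).
  replace (((Dx U t x u + Du U t x u) / Dx X t x u * Dx X t x u - Dx U t x u) / Du U t x u)
    with 1 in E2 by (field; auto).
  split; lra.
Qed.

Lemma dependent_local (t0 x0 u0 : R) : Om t0 x0 u0 ->
  exists e : posreal, forall t x u, box e t0 x0 u0 t x u ->
    (Om t x u /\ T t x u = T t x0 u0 /\ Dt T t x u = Dt T t x0 u0 /\
     Dx X t x u = Dx X t x0 u0 /\ X t x u = X t x0 u0 + Dx X t x0 u0 * (x - x0)) /\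
    U t x u = U t x u0 + Du U t x0 u0 * (u - u0).
Proof.
  intros K; destruct (space_local t0 x0 u0 K) as [e He]; exists e.
  assert (P0 : Rabs (x0 - x0) < e /\ Rabs (u0 - u0) < e)
    by (rewrite !Rminus_diag, Rabs_R0; split; apply cond_pos).
  destruct (proj1 (smooth3_n_S Om 1 _) (HU 2)) as (_ & _ & _ & _ & S).
  intros t x u B; split; [now apply He|].
  destruct B as (B1 & B2 & B3).
  assert (EU : forall v, Rabs (v - u0) < e -> Du U t x v = Du U t x0 u0).
  { intros v Hv; transitivity (Du U t x u0).
    - apply (constant_of_zero_derive (fun v => Du U t x v) u0 e); [|exact Hv].
      intros w Hw; assert (M : Om t x w) by (apply He; repeat split; assumption).
      destruct (dependent_affine t x w M) as (_ & E); rewrite <- E.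
      exact (proj2 (proj2 (smooth3_n_is_derive (Du U) t x w S M))).
    - apply (constant_of_zero_derive (fun y => Du U t y u0) x0 e); [|exact B2].
      intros y Hy; assert (M : Om t y u0) by (apply He; repeat split; tauto).
      destruct (dependent_affine t y u0 M) as (E & _); rewrite <- E.
      exact (proj1 (proj2 (smooth3_n_is_derive (Du U) t y u0 S M))). }
  enough (E : U t x u - Du U t x0 u0 * (u - u0) = U t x u0 - Du U t x0 u0 * (u0 - u0)) by lra.
  apply (constant_of_zero_derive (fun v => U t x v - Du U t x0 u0 * (v - u0)) u0 e);
    [|exact B3].
  intros v Hv.
  assert (M : Om t x v) by (apply He; repeat split; assumption).
  assert (HD : is_derive (fun v => U t x v) v (Du U t x0 u0)).
  { rewrite <- (EU v Hv); exact (proj2 (proj2 (smooth3_n_is_derive U t x v (HU 1) M))). }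
  auto_derive; [eexists; exact HD|].
  replace (Derive (fun v => U t x v) v) with (Du U t x0 u0)
    by (symmetry; now apply is_derive_unique).
  ring.
Qed.

(** * Identities from the terms of lower order *)

(** The images have first derivatives [(0, 0)] and [(- U, 1)]. At this stage [U] may be nonlinear in
    [x], so neither preimage has a known fifth derivative; but [U] is affine in [u] and [X] in [x],
    so the preimages differ by [X_x / U_u * (x - x0)] and the fifth derivatives cancel. Subtracting
    the two source equations leaves the identity. *)
Lemma convection_balance (t0 x0 u0 : R) : Om t0 x0 u0 ->
  Dt T t0 x0 u0 * U t0 x0 u0 = Dt X t0 x0 u0 + u0 * Dx X t0 x0 u0.
Proof.
  intros K; destruct (time_only t0 x0 u0 K) as (Tx & Tu & _).
  destruct (space_affine t0 x0 u0 K) as (Xu & _ & Xx & Uu).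
  assert (Lu : forall p q, lin Du p q t0 x0 u0 = - Du U t0 x0 u0)
    by (intros; unfold lin; rewrite Tu, Xu; ring).
  assert (HN : forall p q, lin Du p q t0 x0 u0 <> 0) by (intros; rewrite Lu; lra).
  destruct (slice_solution_exists t0 x0 u0 0 0 0 0 0 K (HN _ _)) as [phi S1]; [ring|].
  destruct (slice_solution_exists t0 x0 u0 (- U t0 x0 u0) 1 0 0 0 K (HN _ _)) as [phi' S2];
    [ring|].
  destruct S1 as (A1 & A2 & A3 & A4 & A5), S2 as (B1 & B2 & B3 & B4 & B5).
  destruct (smooth1_near_minus phi' phi x0 B2 A2) as [DS DD].
  destruct (dependent_local t0 x0 u0 K) as [e He].
  assert (E : Derive_n (fun x => phi' x - phi x) 5 x0 = 0).
  { rewrite (taylor_unique _ 5 x0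
      (fun k => List.nth k (0 :: Dx X t0 x0 u0 / Du U t0 x0 u0 :: 0 :: 0 :: 0 :: 0 :: nil) 0));
      [simpl; ring|exact DS| |lia].
    apply (limit1_in_ext_loc (fun _ => 0)); [|apply limit1_in_const].
    generalize (filter_and _ _ (filter_and _ _ A3 B3)
      (filter_and _ _ (locally_graph_box e t0 x0 u0 _ phi A1 A4)
                      (locally_graph_box e t0 x0 u0 _ phi' B1 B4))).
    apply filter_imp; intros x ((E1 & E2) & (Ba & Bb)).
    destruct (He _ _ _ Ba) as ((_ & Ta & _ & _ & Xa) & Ua).
    destruct (He _ _ _ Bb) as ((_ & Tb & _ & _ & Xb) & Ub).
    unfold defect, test_fun in E1, E2; rewrite Ta, Xa, Ua in E1; rewrite Tb, Xb, Ub in E2.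
    assert (F : phi' x - phi x = Dx X t0 x0 u0 / Du U t0 x0 u0 * (x - x0)).
    { apply (Rmult_eq_reg_l (Du U t0 x0 u0)); [|exact Uu].
      transitivity (Dx X t0 x0 u0 * (x - x0)); [lra|now field]. }
    rewrite F; simpl; unfold Rdiv; ring. }
  rewrite DD in E.
  rewrite Lu in A5, B5; unfold lin in A5, B5; rewrite Tx in A5, B5.
  assert (F : (- (U t0 x0 u0 * Dt T t0 x0 u0) + Dt X t0 x0 u0 + u0 * Dx X t0 x0 u0)
    / Du U t0 x0 u0 = 0).
  { match type of A5 with ?a = 0 => match type of B5 with ?b = 0 =>
      transitivity (b - a - beta t0 * (Derive_n phi' 5 x0 - Derive_n phi 5 x0));
        [now field|rewrite A5, B5, E; ring] end end. }
  apply (f_equal (fun v => v * Du U t0 x0 u0)) in F.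
  unfold Rdiv in F; rewrite Rmult_assoc, Rinv_l, Rmult_1_r in F by exact Uu; lra.
Qed.

(** [convection_balance] reads [U = (X_t + u * X_x) / T_t]. Here [X], and with it [X_t], is affine
    in [x] with coefficients depending on [t], so [U] is affine in [x] and [u], with coefficients
    [(X_x)_t / T_t] and [X_x / T_t]. *)
Lemma transformation_local (t0 x0 u0 : R) : Om t0 x0 u0 ->
  exists e : posreal, forall t x u, box e t0 x0 u0 t x u ->
    Om t x u /\ Dt T t x0 u0 * Dx U t x0 u0 = Dt (Dx X) t x0 u0 /\
    Dt T t x0 u0 * Du U t x0 u0 = Dx X t x0 u0 /\
    T t x u = T t x0 u0 /\ X t x u = X t x0 u0 + Dx X t x0 u0 * (x - x0) /\
    U t x u = U t x0 u0 + Dx U t x0 u0 * (x - x0) + Du U t x0 u0 * (u - u0).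
Proof.
  intros K; destruct (space_local t0 x0 u0 K) as [e He]; exists e.
  assert (P0 : Rabs (x0 - x0) < e /\ Rabs (u0 - u0) < e)
    by (rewrite !Rminus_diag, Rabs_R0; split; apply cond_pos).
  destruct (proj1 (smooth3_n_S Om 1 _) (HX 2)) as (_ & _ & _ & S & _).
  assert (XT : forall t x u, box e t0 x0 u0 t x u ->
    Dt X t x u = Dt X t x0 u0 + Dt (Dx X) t x0 u0 * (x - x0)).
  { intros t x u (B1 & B2 & B3).
    assert (M : Om t x0 u0) by (apply He; repeat split; tauto).
    destruct (smooth3_n_is_derive X t x0 u0 (HX 1) M) as (D1 & _).
    destruct (smooth3_n_is_derive (Dx X) t x0 u0 S M) as (D2 & _).
    apply is_derive_unique.
    apply (is_derive_ext_loc (fun s => X s x0 u0 + Dx X s x0 u0 * (x - x0))).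
    - assert (P : 0 < e - Rabs (t - t0)) by lra.
      exists (mkposreal _ P); intros s Hs; change (Rabs (s - t) < e - Rabs (t - t0)) in Hs.
      symmetry; apply (He s x u); repeat split; auto.
      replace (s - t0) with ((s - t) + (t - t0)) by ring.
      eapply Rle_lt_trans; [apply Rabs_triang|]; lra.
    - auto_derive; [split; [eexists; exact D1|split; [eexists; exact D2|exact I]]|].
      replace (Derive (fun s => X s x0 u0) t) with (Dt X t x0 u0) by reflexivity.
      replace (Derive (fun s => Dx X s x0 u0) t) with (Dt (Dx X) t x0 u0) by reflexivity.
      ring. }
  intros t x u B.
  assert (Ht : Rabs (t - t0) < e) by apply B.
  assert (Bc : box e t0 x0 u0 t x0 u0) by (repeat split; tauto).
  destruct (He _ _ _ Bc) as (Mc & _).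
  assert (S0 := proj1 (proj2 (proj2 (time_only t x0 u0 Mc)))).
  set (k := Dt (Dx X) t x0 u0 / Dt T t x0 u0); set (th := Dx X t x0 u0 / Dt T t x0 u0).
  assert (EU : forall y v, box e t0 x0 u0 t y v ->
     U t y v = U t x0 u0 + k * (y - x0) + th * (v - u0)).
  { intros y v By; destruct (He _ _ _ By) as (My & _ & Ty & Xy & _).
    pose proof (convection_balance t y v My) as C1.
    pose proof (convection_balance t x0 u0 Mc) as C2.
    rewrite Ty, Xy, (XT t y v By) in C1.
    apply (Rmult_eq_reg_l (Dt T t x0 u0)); [|exact S0].
    transitivity (Dt X t x0 u0 + Dt (Dx X) t x0 u0 * (y - x0) + v * Dx X t x0 u0); [exact C1|].
    transitivity (Dt T t x0 u0 * U t x0 u0 + Dt (Dx X) t x0 u0 * (y - x0)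
      + Dx X t x0 u0 * (v - u0)); [rewrite C2; ring|unfold k, th; now field]. }
  assert (Ek : Dx U t x0 u0 = k).
  { apply is_derive_unique.
    apply (is_derive_ext_loc (fun y => U t x0 u0 + k * (y - x0))).
    - exists e; intros y Hy; rewrite (EU y u0) by (repeat split; tauto || exact Hy).
      change (U t x0 u0 + k * (y - x0) = U t x0 u0 + k * (y - x0) + th * (u0 - u0)); ring.
    - auto_derive; [exact I|ring]. }
  assert (Eth : Du U t x0 u0 = th).
  { apply is_derive_unique.
    apply (is_derive_ext_loc (fun v => U t x0 u0 + th * (v - u0))).
    - exists e; intros v Hv; rewrite (EU x0 v) by (repeat split; tauto || exact Hv).
      change (U t x0 u0 + th * (v - u0) = U t x0 u0 + k * (x0 - x0) + th * (v - u0)); ring.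
    - auto_derive; [exact I|ring]. }
  destruct (He _ _ _ B) as (M & ET & _ & _ & EX).
  split; [exact M|].
  split; [rewrite Ek; unfold k; now field|].
  split; [rewrite Eth; unfold th; now field|].
  split; [exact ET|split; [exact EX|]].
  rewrite Ek, Eth; now apply EU.
Qed.

(** The image is a constant. Since [U] is affine in [x] and [u], the preimage is affine in [x] on
    the slice, its fifth derivative vanishes, and the source equation keeps only its terms of lower
    order. *)
Lemma damping_balance (t0 x0 u0 : R) : Om t0 x0 u0 ->
  Dt U t0 x0 u0 + u0 * Dx U t0 x0 u0 = alpha t0 * u0 * Du U t0 x0 u0.
Proof.
  intros K; destruct (time_only t0 x0 u0 K) as (Tx & Tu & _).
  destruct (space_affine t0 x0 u0 K) as (Xu & _ & Xx & Uu).
  assert (Lu : lin Du 0 0 t0 x0 u0 = - Du U t0 x0 u0) by (unfold lin; ring).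
  destruct (slice_solution_exists t0 x0 u0 0 0 0 0 0 K) as [phi S1]; [rewrite Lu; lra|ring|].
  destruct S1 as (A1 & A2 & A3 & A4 & A5).
  destruct (transformation_local t0 x0 u0 K) as [e He].
  assert (E : Derive_n phi 5 x0 = 0).
  { rewrite (taylor_unique _ 5 x0
      (fun k => List.nth k (u0 :: - (Dx U t0 x0 u0 / Du U t0 x0 u0) :: 0 :: 0 :: 0 :: 0 :: nil) 0));
      [simpl; ring|exact A2| |lia].
    apply (limit1_in_ext_loc (fun _ => 0)); [|apply limit1_in_const].
    generalize (filter_and _ _ A3 (locally_graph_box e t0 x0 u0 _ phi A1 A4)).
    apply filter_imp; intros x (E1 & B).
    destruct (He _ _ _ B) as (_ & _ & _ & _ & _ & Ub).
    unfold defect, test_fun in E1; rewrite Ub in E1.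
    assert (F : phi x = u0 + - (Dx U t0 x0 u0 / Du U t0 x0 u0) * (x - x0)).
    { apply (Rmult_eq_reg_l (Du U t0 x0 u0)); [|exact Uu].
      transitivity (Du U t0 x0 u0 * u0 - Dx U t0 x0 u0 * (x - x0)); [lra|now field]. }
    rewrite F; simpl; unfold Rdiv; ring. }
  rewrite E, Lu in A5; unfold lin in A5.
  match type of A5 with ?a = 0 =>
    apply Rminus_diag_uniq; transitivity (- (a * Du U t0 x0 u0));
      [now field|rewrite A5; ring] end.
Qed.

(** With [U] affine, [damping_balance] is an identity between functions affine in [x] and [u]: the
    coefficient of [x] gives [k' = 0] and that of [u] gives [th' + k = alpha * th]. *)
Lemma structure_equations (t0 x0 u0 : R) : Om t0 x0 u0 ->
  exists (e : posreal) (S a k th : R -> R), forall t, Rabs (t - t0) < e ->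
    Om t x0 u0 /\ S t <> 0 /\ a t <> 0 /\ S t * th t = a t /\ beta t * a t ^ 5 = mu * S t /\
    is_derive a t (S t * k t) /\ is_derive k t 0 /\ is_derive th t (alpha t * th t - k t).
Proof.
  intros K; destruct (transformation_local t0 x0 u0 K) as [e He].
  exists e, (fun t => Dt T t x0 u0), (fun t => Dx X t x0 u0), (fun t => Dx U t x0 u0),
    (fun t => Du U t x0 u0).
  assert (P0 : Rabs (x0 - x0) < e /\ Rabs (u0 - u0) < e)
    by (rewrite !Rminus_diag, Rabs_R0; split; apply cond_pos).
  destruct (proj1 (smooth3_n_S Om 1 _) (HX 2)) as (_ & _ & _ & SX & _).
  destruct (proj1 (smooth3_n_S Om 1 _) (HU 2)) as (_ & _ & _ & SU1 & SU2).
  intros t Ht.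
  assert (Bc : box e t0 x0 u0 t x0 u0) by (repeat split; tauto).
  destruct (He _ _ _ Bc) as (M & E1 & E2 & _).
  destruct (space_affine t x0 u0 M) as (_ & EB & Xx & _).
  destruct (smooth3_n_is_derive (Dx X) t x0 u0 SX M) as (DX & _).
  destruct (smooth3_n_is_derive (Dx U) t x0 u0 SU1 M) as (Dk & _).
  destruct (smooth3_n_is_derive (Du U) t x0 u0 SU2 M) as (Dth & _).
  destruct (smooth3_n_is_derive U t x0 u0 (HU 1) M) as (DU & _).
  assert (UT : forall x u, box e t0 x0 u0 t x u ->
    Dt U t x u = Dt U t x0 u0 + Dt (Dx U) t x0 u0 * (x - x0) + Dt (Du U) t x0 u0 * (u - u0) /\
    Dx U t x u = Dx U t x0 u0 /\ Du U t x u = Du U t x0 u0).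
  { intros x u (B1 & B2 & B3).
    assert (P : 0 < e - Rabs (t - t0)) by lra.
    assert (Px : 0 < e - Rabs (x - x0)) by lra.
    assert (Pu : 0 < e - Rabs (u - u0)) by lra.
    split; [|split]; apply is_derive_unique.
    - apply (is_derive_ext_loc (fun s => U s x0 u0 + Dx U s x0 u0 * (x - x0)
                                          + Du U s x0 u0 * (u - u0))).
      + exists (mkposreal _ P); intros s Hs; change (Rabs (s - t) < e - Rabs (t - t0)) in Hs.
        symmetry; apply (He s x u); repeat split; auto.
        replace (s - t0) with ((s - t) + (t - t0)) by ring.
        eapply Rle_lt_trans; [apply Rabs_triang|]; lra.
      + auto_derive.
        * split; [eexists; exact DU|split; [eexists; exact Dk|split; [eexists; exact Dth|exact I]]].
        * replace (Derive (fun s => U s x0 u0) t) with (Dt U t x0 u0) by reflexivity.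
          replace (Derive (fun s => Dx U s x0 u0) t) with (Dt (Dx U) t x0 u0) by reflexivity.
          replace (Derive (fun s => Du U s x0 u0) t) with (Dt (Du U) t x0 u0) by reflexivity.
          ring.
    - apply (is_derive_ext_loc (fun y => U t x0 u0 + Dx U t x0 u0 * (y - x0)
                                          + Du U t x0 u0 * (u - u0))).
      + exists (mkposreal _ Px); intros y Hy; change (Rabs (y - x) < e - Rabs (x - x0)) in Hy.
        symmetry; apply (He t y u); repeat split; auto.
        replace (y - x0) with ((y - x) + (x - x0)) by ring.
        eapply Rle_lt_trans; [apply Rabs_triang|]; lra.
      + auto_derive; [exact I|ring].
    - apply (is_derive_ext_loc (fun v => U t x0 u0 + Dx U t x0 u0 * (x - x0)
                                          + Du U t x0 u0 * (v - u0))).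
      + exists (mkposreal _ Pu); intros v Hv; change (Rabs (v - u) < e - Rabs (u - u0)) in Hv.
        symmetry; apply (He t x v); repeat split; auto.
        replace (v - u0) with ((v - u) + (u - u0)) by ring.
        eapply Rle_lt_trans; [apply Rabs_triang|]; lra.
      + auto_derive; [exact I|ring]. }
  pose proof (cond_pos e) as Pe.
  (* Evaluation at the base point and at its shifts by [e / 2] in [x] and in [u] isolates the two
     coefficients. *)
  assert (Hh : Rabs (x0 + e / 2 - x0) < e /\ Rabs (u0 + e / 2 - u0) < e)
    by (split; apply Rabs_def1; lra).
  assert (Bx : box e t0 x0 u0 t (x0 + e / 2) u0) by (repeat split; tauto).
  assert (Bu : box e t0 x0 u0 t x0 (u0 + e / 2)) by (repeat split; tauto).
  pose proof (damping_balance t x0 u0 M) as C0.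
  pose proof (damping_balance _ _ _ (proj1 (He _ _ _ Bx))) as Cx.
  pose proof (damping_balance _ _ _ (proj1 (He _ _ _ Bu))) as Cu.
  destruct (UT _ _ Bx) as (F1 & F2 & F3); rewrite F1, F2, F3 in Cx.
  destruct (UT _ _ Bu) as (G1 & G2 & G3); rewrite G1, G2, G3 in Cu.
  assert (K0 : Dt (Dx U) t x0 u0 = 0).
  { apply (Rmult_eq_reg_r (e / 2)); [|lra].
    replace (x0 + e / 2 - x0) with (e / 2) in Cx by ring.
    rewrite Rminus_diag in Cx; lra. }
  assert (T0 : Dt (Du U) t x0 u0 = alpha t * Du U t x0 u0 - Dx U t x0 u0).
  { apply (Rmult_eq_reg_r (e / 2)); [|lra].
    replace (u0 + e / 2 - u0) with (e / 2) in Cu by ring.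
    rewrite Rminus_diag in Cu; lra. }
  rewrite K0 in Dk; rewrite T0 in Dth; rewrite <- E1 in DX.
  split; [exact M|split; [exact (proj1 (proj2 (proj2 (time_only t x0 u0 M))))|]].
  split; [exact Xx|split; [exact E2|split; [symmetry; exact EB|]]].
  split; [exact DX|split; [exact Dk|exact Dth]].
Qed.

End Reduction.

(** * Solving the structure equations *)

Lemma in_itv_between (a b : Rbar) (s t v : R) :
  in_itv a b s -> in_itv a b t -> s <= v <= t -> in_itv a b v.
Proof.
  intros [H1 _] [_ H2] [H3 H4]; split.
  - exact (Rbar_lt_le_trans a s v H1 H3).
  - exact (Rbar_le_lt_trans v t b H4 H2).
Qed.

Lemma in_itv_nonempty (a b : Rbar) : Rbar_lt a b -> exists t, in_itv a b t.
Proof.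
  unfold in_itv; destruct a as [a| |], b as [b| |]; simpl; intros H; try contradiction.
  - exists ((a + b) / 2); lra.
  - exists (a + 1); split; [lra|exact I].
  - exists (b - 1); split; [exact I|lra].
  - exists 0; split; exact I.
Qed.

Lemma constant_on_itv (a b : Rbar) (f : R -> R) :
  (forall t, in_itv a b t -> locally t (fun s => f s = f t)) ->
  forall s t, in_itv a b s -> in_itv a b t -> f s = f t.
Proof.
  intros H.
  assert (L : forall s t, in_itv a b s -> in_itv a b t -> s < t -> f s = f t).
  { intros s t Hs Ht Hst; apply (eq_is_derive f s t); [|exact Hst].
    intros v Hv; apply (is_derive_ext_loc (fun _ => f v)); [|apply @is_derive_const].
    assert (Iv := in_itv_between a b s t v Hs Ht Hv).
    generalize (H v Iv); apply filter_imp; intros; congruence. }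
  intros s t Hs Ht; destruct (Rtotal_order s t) as [K|[->|K]];
    [now apply L|reflexivity|symmetry; now apply L].
Qed.

Lemma cube_root_exists (y : R) : y <> 0 -> exists x, x ^ 3 = y.
Proof.
  intros Hy.
  assert (P : forall z, 0 < z -> exp (ln z / 3) ^ 3 = z).
  { intros z Hz; simpl; rewrite Rmult_1_r, <- !exp_plus.
    replace (ln z / 3 + (ln z / 3 + ln z / 3)) with (ln z) by field; now apply exp_ln. }
  destruct (Rtotal_order y 0) as [K|[K|K]]; [|contradiction|].
  - exists (- exp (ln (- y) / 3)).
    transitivity (- (exp (ln (- y) / 3) ^ 3)); [ring|rewrite P; lra].
  - exists (exp (ln y / 3)); now apply P.
Qed.

Lemma beta_local_form (alpha beta A B S a k th : R -> R) (mu t0 : R) (e : posreal) :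
  mu <> 0 ->
  (forall t, Rabs (t - t0) < e -> is_derive A t (alpha t) /\ is_derive B t (exp (- A t)) /\
    S t <> 0 /\ a t <> 0 /\ S t * th t = a t /\ beta t * a t ^ 5 = mu * S t /\
    is_derive a t (S t * k t) /\ is_derive k t 0 /\ is_derive th t (alpha t * th t - k t)) ->
  exists c1 c2, forall t, Rabs (t - t0) < e ->
    beta t = exp (- A t) * (c1 * B t + c2) ^ 3.
Proof.
  intros Hmu H.
  set (C := a t0 * th t0 * exp (- A t0)).
  assert (H0 : Rabs (t0 - t0) < e) by (rewrite Rminus_diag, Rabs_R0; apply cond_pos).
  (* The derivative is [(S * th - a) * k * exp (- A)], which is 0 because [S * th = a]. *)
  assert (HC : forall t, Rabs (t - t0) < e -> a t * th t * exp (- A t) = C).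
  { apply (constant_of_zero_derive (fun t => a t * th t * exp (- A t))).
    intros t Ht; destruct (H t Ht) as (DA & _ & _ & _ & E & _ & Da & _ & Dth).
    auto_derive.
    - repeat split; eexists; eassumption.
    - replace (Derive (fun x => A x) t) with (alpha t) by (symmetry; now apply is_derive_unique).
      replace (Derive (fun x => a x) t) with (S t * k t) by (symmetry; now apply is_derive_unique).
      replace (Derive (fun x => th x) t) with (alpha t * th t - k t)
        by (symmetry; now apply is_derive_unique).
      rewrite <- E; ring. }
  assert (Hth : forall t, Rabs (t - t0) < e -> th t <> 0).
  { intros t Ht Z; destruct (H t Ht) as (_ & _ & _ & Na & E & _).
    apply Na; rewrite <- E, Z; ring. }
  assert (NC : C <> 0).
  { destruct (H t0 H0) as (_ & _ & _ & Na & _); unfold C; pose proof (exp_pos (- A t0)).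
    repeat apply Rmult_integral_contrapositive_currified; auto; lra. }
  assert (Hk : forall t, Rabs (t - t0) < e -> k t = k t0).
  { apply constant_of_zero_derive; intros t Ht; apply (H t Ht). }
  (* [(/ a)' = - S * k / a^2 = - k / (a * th) = - (k / C) * exp (- A)], so [c] makes [/ a - c * B]
     constant. *)
  set (c := - (k t0 / C)).
  set (d := / a t0 - c * B t0).
  assert (Ha : forall t, Rabs (t - t0) < e -> / a t - c * B t = d).
  { apply (constant_of_zero_derive (fun t => / a t - c * B t)).
    intros t Ht; destruct (H t Ht) as (_ & DB & _ & Na & E & _ & Da & _).
    auto_derive.
    - split; [eexists; exact Da|split; [exact Na|split; [eexists; exact DB|exact I]]].
    - replace (Derive (fun x => B x) t) with (exp (- A t)) by (symmetry; now apply is_derive_unique).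
      replace (Derive (fun x => a x) t) with (S t * k t) by (symmetry; now apply is_derive_unique).
      rewrite (Hk t Ht); unfold c; rewrite <- (HC t Ht), <- E.
      pose proof (Hth t Ht); pose proof (exp_pos (- A t)).
      assert (S t <> 0) by (intros Z; apply Na; rewrite <- E, Z; ring).
      field; repeat split; auto; lra. }
  (* The factor [mu / C] is moved inside the cube [(/ a)^3] through its real cube root. *)
  destruct (cube_root_exists (mu / C)) as [r Hr].
  { apply Rmult_integral_contrapositive_currified; [exact Hmu|now apply Rinv_neq_0_compat]. }
  exists (r * c), (r * d); intros t Ht.
  destruct (H t Ht) as (_ & _ & NS & Na & E & EB & _).
  replace (r * c * B t + r * d) with (r * / a t) by (rewrite <- (Ha t Ht); ring).
  rewrite Rpow_mult_distr, Hr, <- (HC t Ht).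
  apply (Rmult_eq_reg_r (a t ^ 5)); [|now apply pow_nonzero].
  rewrite EB, <- E.
  pose proof (Hth t Ht); pose proof (exp_pos (- A t)).
  field; repeat split; auto; lra.
Qed.

Lemma glue_local_forms (a b : Rbar) (A B beta : R -> R) :
  (forall t, in_itv a b t -> is_derive B t (exp (- A t))) ->
  (forall t, in_itv a b t -> exists c1 c2, locally t (fun s => in_itv a b s /\
    beta s = exp (- A s) * (c1 * B s + c2) ^ 3)) ->
  exists c1 c2, forall t, in_itv a b t -> beta t = exp (- A t) * (c1 * B t + c2) ^ 3.
Proof.
  intros HB H.
  (* The local constants come without any coherence in [t]. Real cube roots are unique, so this [w],
     defined from [beta] and [A] alone, equals every local expression [c1 * B + c2] where that is
     valid. *)
  set (w := fun t => epsilon (inhabits 0) (fun x => x ^ 3 = beta t * exp (A t))).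
  assert (Hw : forall t c1 c2, beta t = exp (- A t) * (c1 * B t + c2) ^ 3 ->
    w t = c1 * B t + c2).
  { intros t c1 c2 E.
    assert (E' : (c1 * B t + c2) ^ 3 = beta t * exp (A t)).
    { rewrite E, exp_Ropp; field; apply Rgt_not_eq, exp_pos. }
    apply pow3_inj; rewrite E'.
    apply (epsilon_spec (inhabits 0) (fun x => x ^ 3 = beta t * exp (A t))).
    now exists (c1 * B t + c2). }
  set (h := fun t => Derive w t * exp (A t)).
  assert (Hloc : forall t, in_itv a b t -> exists c1 c2, locally t (fun s => in_itv a b s /\
    w s = c1 * B s + c2 /\ h s = c1)).
  { intros t Ht; destruct (H t Ht) as (c1 & c2 & L); exists c1, c2.
    assert (L' : locally t (fun s => in_itv a b s /\ w s = c1 * B s + c2)).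
    { revert L; apply filter_imp; intros s [I E]; split; [exact I|now apply Hw]. }
    generalize (filter_and _ _ L' (locally_locally t _ L')).
    apply filter_imp; intros s [[I E] Ls]; split; [exact I|split; [exact E|]].
    unfold h; rewrite (Derive_ext_loc w (fun s : R => c1 * B s + c2));
      [|revert Ls; apply filter_imp; intros v [_ Ev]; exact Ev].
    replace (Derive (fun s : R => c1 * B s + c2) s) with (c1 * exp (- A s)).
    - rewrite exp_Ropp; field; apply Rgt_not_eq, exp_pos.
    - symmetry; apply is_derive_unique; auto_derive; [eexists; exact (HB s I)|].
      replace (Derive (fun x => B x) s) with (exp (- A s))
        by (symmetry; now apply is_derive_unique, HB).
      ring. }
  destruct (classic (exists t, in_itv a b t)) as [[t0 I0]|N].
  2: { exists 0, 0; intros t I; exfalso; apply N; now exists t. }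
  assert (Hh : forall t, in_itv a b t -> h t = h t0).
  { intros t I; apply (constant_on_itv a b h); auto.
    clear t I; intros t I; destruct (Hloc t I) as (c1 & c2 & L).
    pose proof (locally_singleton _ _ L) as (_ & _ & E0).
    revert L; apply filter_imp; intros s (_ & _ & E); congruence. }
  set (g := fun t => w t - h t0 * B t).
  assert (Hg : forall t, in_itv a b t -> g t = g t0).
  { intros t I; apply (constant_on_itv a b g); auto.
    clear t I; intros t I; destruct (Hloc t I) as (c1 & c2 & L).
    pose proof (locally_singleton _ _ L) as (_ & E0 & _).
    pose proof (locally_singleton _ _ L) as (_ & _ & F0).
    rewrite (Hh t I) in F0.
    revert L; apply filter_imp; intros s (_ & E & _); unfold g; rewrite E, E0, F0; ring. }
  exists (h t0), (g t0); intros t I.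
  rewrite <- (Hg t I); unfold g.
  destruct (H t I) as (c1 & c2 & L); destruct (locally_singleton _ _ L) as [_ E].
  rewrite E, <- (Hw t c1 c2 E) at 1; f_equal; f_equal; ring.
Qed.

Lemma reducible_necessary (a b : Rbar) (alpha beta A B : R -> R) :
  Rbar_lt a b ->
  (forall t, in_itv a b t -> beta t <> 0) ->
  (forall t, in_itv a b t -> is_derive A t (alpha t)) ->
  (forall t, in_itv a b t -> is_derive B t (exp (- A t))) ->
  reducible a b alpha beta ->
  exists c1 c2 : R, (c1, c2) <> (0, 0) /\
    forall t, in_itv a b t -> beta t = exp (- A t) * (c1 * B t + c2) ^ 3.
Proof.
  intros hab Hb HA HB (mu & Om & T & X & U & Hmu & HI & Hcov & HTr & Hm).
  destruct (glue_local_forms a b A B beta HB) as (c1 & c2 & Hc).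
  - intros t It; destruct (Hcov t It) as (x & u & K).
    assert (Hb' : forall t x u, Om t x u -> beta t <> 0) by (intros; eapply Hb, HI; eauto).
    destruct (structure_equations alpha beta mu Om T X U Hmu Hb' HTr Hm t x u K)
      as (e & S & a' & k & th & HS).
    destruct (beta_local_form alpha beta A B S a' k th mu t e Hmu) as (c1 & c2 & Hc).
    + intros s Hs; destruct (HS s Hs) as (M & R).
      assert (Is := HI _ _ _ M).
      split; [now apply HA|split; [now apply HB|exact R]].
    + exists c1, c2, e; intros s Hs; split; [|now apply Hc].
      destruct (HS s Hs) as (M & _); exact (HI _ _ _ M).
  - exists c1, c2; split; [|exact Hc].
    (* Two zero constants would make [beta] vanish at a point of the nonempty interval. *)
    intros E; injection E as -> ->.
    destruct (in_itv_nonempty a b hab) as [t It].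
    apply (Hb t It); rewrite (Hc t It); ring.
Qed.

(** * The transformation to constant coefficients *)

Section Normal_form.
Variables (a b : Rbar) (alpha beta A B : R -> R) (c1 c2 : R).
Hypothesis halpha : smooth_on_itv a b alpha.
Hypothesis hA : forall t, in_itv a b t -> is_derive A t (alpha t).
Hypothesis hB : forall t, in_itv a b t -> is_derive B t (exp (- A t)).
Hypothesis hw : forall t, in_itv a b t -> c1 * B t + c2 <> 0.

Let Om (t x u : R) : Prop := in_itv a b t.
Let w (t : R) : R := c1 * B t + c2.

Lemma in_itv_open (t : R) : in_itv a b t -> locally t (in_itv a b).
Proof.
  intros [H1 H2]; apply filter_and.
  - exact (open_Rbar_gt' t a H1).
  - exact (open_Rbar_lt' t b H2).
Qed.

Let HO : open3 Om.
Proof.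
  intros [[t x] u] H; destruct (in_itv_open t H) as [d Hd].
  apply locally_box; exists d; intros s y v (H1 & _); exact (Hd s H1).
Qed.

(** * Smoothness of functions of [t] known through their derivatives *)

(** The means to bootstrap: [A] and [B] are given by their first derivatives only, and each order of
    the derivative provides the next order of the function. *)
Lemma smooth3_n_time (h h' : R -> R) (n : nat) :
  (forall t, in_itv a b t -> is_derive h t (h' t)) ->
  smooth3_n Om 0 (fun t _ _ => h t) /\
  (smooth3_n Om n (fun t _ _ => h' t) -> smooth3_n Om (S n) (fun t _ _ => h t)).
Proof.
  intros H.
  assert (HC : forall t x u, Om t x u -> continuous (uncurry3 (fun t _ _ => h t)) (t, x, u)).
  { intros t x u K; apply (continuous_comp (fun p : R * R * R => fst (fst p)) h).
    - apply (continuous_comp fst fst); apply continuous_fst.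
    - exact (ex_derive_continuous h t (ex_intro _ _ (H t K))). }
  split; [now apply smooth3_n_0|].
  intros Hn; apply smooth3_n_S; split; [exact HC|split; [|split; [|split]]].
  - intros t x u K; split; [exists (h' t); now apply H|split; apply ex_derive_const].
  - apply (smooth3_n_ext Om HO n (fun t _ _ => h' t)); [|exact Hn].
    intros t x u K; symmetry; apply is_derive_unique; now apply H.
  - apply (smooth3_n_ext Om HO n (fun _ _ _ => 0)); [|apply smooth3_n_const].
    intros t x u K; symmetry; unfold Dx; apply Derive_const.
  - apply (smooth3_n_ext Om HO n (fun _ _ _ => 0)); [|apply smooth3_n_const].
    intros t x u K; symmetry; unfold Du; apply Derive_const.
Qed.

Lemma smooth3_n_alpha (n : nat) : smooth3_n Om n (fun t _ _ => alpha t).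
Proof.
  enough (H : forall k, smooth3_n Om n (fun t _ _ => Derive_n alpha k t)) by exact (H 0%nat).
  assert (D : forall k t, in_itv a b t -> is_derive (Derive_n alpha k) t (Derive_n alpha (S k) t)).
  { intros k t Ht; apply Derive_correct; exact (halpha t Ht (S k)). }
  induction n as [|n IH]; intros k.
  - exact (proj1 (smooth3_n_time _ _ 0 (D k))).
  - exact (proj2 (smooth3_n_time _ _ n (D k)) (IH (S k))).
Qed.

(** [exp A] solves [y' = alpha * y], so order [n] of [y] gives order [n + 1]. *)
Lemma smooth3_n_expA (n : nat) : smooth3_n Om n (fun t _ _ => exp (A t)).
Proof.
  assert (D : forall t, in_itv a b t -> is_derive (fun t => exp (A t)) t (alpha t * exp (A t))).
  { intros t Ht; exact (is_derive_comp exp A t _ _ (is_derive_exp (A t)) (hA t Ht)). }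
  induction n as [|n IH].
  - exact (proj1 (smooth3_n_time _ _ 0 D)).
  - apply (proj2 (smooth3_n_time _ _ n D)).
    exact (smooth3_n_mult Om HO n _ _ (smooth3_n_alpha n) IH).
Qed.

Lemma smooth3_n_B (n : nat) : smooth3_n Om n (fun t _ _ => B t).
Proof.
  destruct n as [|n]; [exact (proj1 (smooth3_n_time _ _ 0 hB))|].
  apply (proj2 (smooth3_n_time _ _ n hB)).
  apply (smooth3_n_ext Om HO n (fun t _ _ => / exp (A t))).
  - intros t _ _ _; now rewrite exp_Ropp.
  - apply (smooth3_n_inv Om HO n (fun t _ _ => exp (A t))); [|apply smooth3_n_expA].
    intros t _ _ _; apply Rgt_not_eq, exp_pos.
Qed.

Lemma smooth3_n_w (n : nat) : smooth3_n Om n (fun t _ _ => w t).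
Proof.
  exact (smooth3_n_plus Om HO n _ _
    (smooth3_n_mult Om HO n _ _ (smooth3_n_const Om n c1) (smooth3_n_B n))
    (smooth3_n_const Om n c2)).
Qed.

(* For c1 = 0 the antiderivative - 1 / (c1 w) of exp (-A) / w^2 degenerates, and w = c2. *)
Definition new_time (t : R) : R :=
  if Req_EM_T c1 0 then B t * / (c2 * c2) else - / c1 * / (c1 * B t + c2).

Lemma new_time_is_derive (t : R) : in_itv a b t ->
  is_derive new_time t (exp (- A t) / w t ^ 2).
Proof.
  intros Ht; pose proof (hw t Ht) as N; unfold new_time, w in *.
  assert (E : Derive (fun x => B x) t = exp (- A t)) by (apply is_derive_unique; exact (hB _ Ht)).
  assert (X : ex_derive (fun x => B x) t) by (eexists; exact (hB _ Ht)).
  destruct (Req_EM_T c1 0) as [Z|Z].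
  - rewrite Z in N |- *; auto_derive; [tauto|]; rewrite E; field; lra.
  - auto_derive; [tauto|]; rewrite E; field; auto.
Qed.

Lemma normal_form_point_transformation :
  point_transformation Om (fun t _ _ => new_time t) (fun t x _ => x * / w t)
    (fun t x u => w t * exp (A t) * u - c1 * x).
Proof.
  assert (SI : forall n, smooth3_n Om n (fun t _ _ => / w t)).
  { intros n; apply (smooth3_n_inv Om HO n (fun t _ _ => w t)); [|apply smooth3_n_w].
    intros t x u Ht; exact (hw t Ht). }
  split; [exact HO|split; [|split; [|split]]].
  - intros t x u K n; revert t x u K; change (smooth3_n Om n (fun t _ _ => new_time t)).
    unfold new_time; destruct (Req_EM_T c1 0).
    + exact (smooth3_n_mult Om HO n _ _ (smooth3_n_B n) (smooth3_n_const Om n _)).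
    + exact (smooth3_n_mult Om HO n _ _ (smooth3_n_const Om n _) (SI n)).
  - intros t x u K n; revert t x u K; change (smooth3_n Om n (fun t x _ => x * / w t)).
    exact (smooth3_n_mult Om HO n _ _ (proj1 (proj2 (smooth3_n_coord Om n))) (SI n)).
  - intros t x u K n; revert t x u K.
    change (smooth3_n Om n (fun t x u => w t * exp (A t) * u - c1 * x)).
    exact (smooth3_n_minus Om HO n _ _
      (smooth3_n_mult Om HO n _ _
        (smooth3_n_mult Om HO n _ _ (smooth3_n_w n) (smooth3_n_expA n))
        (proj2 (proj2 (smooth3_n_coord Om n))))
      (smooth3_n_mult Om HO n _ _ (smooth3_n_const Om n c1)
        (proj1 (proj2 (smooth3_n_coord Om n))))).
  - intros t x u K; pose proof (hw t K) as N; fold (w t) in N; unfold jacobian.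
    replace (Dt (fun t _ _ => new_time t) t x u) with (exp (- A t) / w t ^ 2)
      by (symmetry; apply is_derive_unique; exact (new_time_is_derive t K)).
    replace (Dx (fun t _ _ => new_time t) t x u) with 0 by (symmetry; unfold Dx; apply Derive_const).
    replace (Du (fun t _ _ => new_time t) t x u) with 0 by (symmetry; unfold Du; apply Derive_const).
    replace (Du (fun t x _ => x * / w t) t x u) with 0 by (symmetry; unfold Du; apply Derive_const).
    replace (Dx (fun t x _ => x * / w t) t x u) with (/ w t).
    2: { symmetry; apply is_derive_unique; auto_derive; [exact I|ring]. }
    replace (Du (fun t x u => w t * exp (A t) * u - c1 * x) t x u) with (w t * exp (A t)).
    2: { symmetry; apply is_derive_unique; auto_derive; [exact I|ring]. }
    rewrite exp_Ropp; pose proof (exp_pos (A t)).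
    (* The Jacobian matrix is triangular; its diagonal entries [exp (- A) / w^2], [/ w] and
       [w * exp A] multiply to [/ w^2]. *)
    match goal with |- ?e <> 0 => replace e with (/ (w t ^ 2)) end.
    + apply Rinv_neq_0_compat, pow_nonzero, N.
    + field; split; [exact N|lra].
Qed.

(** * Correspondence of the two equations *)

Hypothesis hbeta : forall t, in_itv a b t -> beta t = exp (- A t) * w t ^ 3.

Lemma smooth1_near_scale (g : R -> R) (c x : R) :
  smooth1_near g (c * x) -> smooth1_near (fun y => g (c * y)) x /\
  forall n, Derive_n (fun y => g (c * y)) n x = c ^ n * Derive_n g n (c * x).
Proof.
  unfold smooth1_near; intros H; split.
  - assert (C : continuous (fun y => c * y) x).
    { apply (continuous_mult (fun _ => c) (fun y => y));
        [apply continuous_const|apply continuous_id]. }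
    pose proof (C _ (locally_locally _ _ H)) as L; unfold filtermap in L.
    revert L; apply filter_imp; intros y Hy n.
    apply ex_derive_n_comp_scal; revert Hy; apply filter_imp; auto.
  - intros n; apply Derive_n_comp_scal; revert H; apply filter_imp; auto.
Qed.

Lemma smooth1_near_scal (f : R -> R) (c x : R) :
  smooth1_near f x -> smooth1_near (fun y => c * f y) x.
Proof.
  unfold smooth1_near; apply filter_imp; intros y Hy n; now apply ex_derive_n_scal_l.
Qed.

(** Differentiating the graph relation once in [t], once in [x] and five times in [x] expresses the
    derivatives of [f] through those of [g]. The left side of the target equation is then that of
    the source equation times a nonvanishing factor, which gives both implications at once. *)
Lemma normal_form_maps_equation :
  maps_equation Om (fun t _ _ => new_time t) (fun t x _ => x * / w t)
    (fun t x u => w t * exp (A t) * u - c1 * x) (vc_kdv5 alpha beta) (cc_kdv5 1).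
Proof.
  intros f g t0 x0 u0 t1 x1 K Hf Hg Hfg.
  assert (Ht : in_itv a b t0) by exact K.
  pose proof (hw t0 Ht) as N; fold (w t0) in N.
  unfold carries_graph in Hfg; unfold t1, x1 in *; clear t1 x1.
  set (t1 := new_time t0) in *; set (x1 := x0 * / w t0) in *.
  set (E := exp (A t0)); assert (PE : 0 < E) by apply exp_pos.
  assert (EN : exp (- A t0) = / E) by (apply exp_Ropp).
  assert (G0 : g t1 x1 = w t0 * E * f t0 x0 - c1 * x0)
    by exact (locally_2d_singleton _ _ _ Hfg).
  pose proof (locally_2d_1d_const_x _ _ _ Hfg) as Lx; simpl in Lx.
  pose proof (locally_2d_1d_const_y _ _ _ Hfg) as Lt; simpl in Lt.
  pose proof (locally_2d_singleton _ _ _ Hf 1%nat) as (_ & F1 & F2 & _).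
  (* Along the [t]-direction both arguments of [g] move, so joint differentiability is required. *)
  assert (DG : differentiable_pt_lim g t1 x1 (Derive (fun s => g s x1) t1)
                 (Derive (fun y => g t1 y) x1)).
  { pose proof (locally_2d_singleton _ _ _ Hg 1%nat) as (_ & _ & G2 & (G3 & _) & _).
    apply differentiable_of_C1; [|exact G2|exact G3].
    revert Hg; apply locally_2d_impl, locally_2d_forall; intros s y H.
    destruct (H 1%nat) as (_ & H1 & _); exact H1. }
  assert (Gx : is_derive (fun y => g t1 y) x1 (Derive (fun y => g t1 y) x1)).
  { apply Derive_correct; exact (proj1 (proj2 (proj2 (locally_2d_singleton _ _ _ Hg 1%nat)))). }
  apply Derive_correct in F1; apply Derive_correct in F2.
  set (ft := Derive (fun s => f s x0) t0) in *.
  set (fx := Derive (fun y => f t0 y) x0) in *.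
  set (gt := Derive (fun s => g s x1) t1) in *.
  set (gx := Derive (fun y => g t1 y) x1) in *.
  set (f5 := Derive_n (fun y => f t0 y) 5 x0).
  set (g5 := Derive_n (fun y => g t1 y) 5 x1).
  assert (Ex : gx * / w t0 = w t0 * E * fx - c1).
  { assert (H1 : is_derive (fun x => g t1 (x * / w t0)) x0 (/ w t0 * gx)).
    { apply (is_derive_comp (fun y => g t1 y) (fun x => x * / w t0) x0 gx (/ w t0) Gx).
      auto_derive; [exact I|ring]. }
    assert (H2 : is_derive (fun x => w t0 * E * f t0 x - c1 * x) x0 (w t0 * E * fx - c1)).
    { assert (XF : ex_derive (fun x : R => f t0 x) x0) by (eexists; exact F2).
      auto_derive; [tauto|].
      replace (Derive (fun x => f t0 x) x0) with fx by reflexivity; ring. }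
    apply (is_derive_ext_loc _ _ _ _ Lx) in H1.
    rewrite Rmult_comm, <- (is_derive_unique _ _ _ H1), <- (is_derive_unique _ _ _ H2).
    reflexivity. }
  assert (Hw : is_derive w t0 (c1 * / E)).
  { rewrite <- EN; unfold w;
    assert (XB : ex_derive (fun x : R => B x) t0) by (eexists; exact (hB _ Ht)).
    auto_derive; [tauto|].
    replace (Derive (fun x => B x) t0) with (exp (- A t0))
      by (symmetry; apply is_derive_unique; exact (hB _ Ht)).
    ring. }
  assert (Et : gt * (/ E / w t0 ^ 2) + gx * (- (x0 * (c1 * / E)) / w t0 ^ 2)
    = (c1 * / E * E + w t0 * (alpha t0 * E)) * f t0 x0 + w t0 * E * ft).
  { assert (H1 : is_derive (fun t => g (new_time t) (x0 * / w t)) t0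
      (gt * (/ E / w t0 ^ 2) + gx * (- (x0 * (c1 * / E)) / w t0 ^ 2))).
    { apply (is_derive_comp_2d g new_time (fun t => x0 * / w t)); [exact DG| |].
      - rewrite <- EN; now apply new_time_is_derive.
      - assert (Xw : ex_derive (fun x : R => w x) t0) by (eexists; exact Hw).
        auto_derive; [tauto|].
        replace (Derive (fun x => w x) t0) with (c1 * / E)
          by (symmetry; now apply is_derive_unique).
        field; split; [lra|exact N]. }
    assert (H2 : is_derive (fun t => w t * exp (A t) * f t x0 - c1 * x0) t0
      ((c1 * / E * E + w t0 * (alpha t0 * E)) * f t0 x0 + w t0 * E * ft)).
    { assert (Xw : ex_derive (fun x : R => w x) t0) by (eexists; exact Hw).
      assert (XA : ex_derive (fun x : R => A x) t0) by (eexists; exact (hA _ Ht)).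
      assert (XF : ex_derive (fun x : R => f x x0) t0) by (eexists; exact F1).
      auto_derive.
      - tauto.
      - replace (Derive (fun x => w x) t0) with (c1 * / E)
          by (symmetry; now apply is_derive_unique).
        replace (Derive (fun x => A x) t0) with (alpha t0)
          by (symmetry; apply is_derive_unique; exact (hA _ Ht)).
        replace (Derive (fun x => f x x0) t0) with ft by reflexivity.
        fold E; ring. }
    apply (is_derive_ext_loc _ _ _ _ Lt) in H1.
    rewrite <- (is_derive_unique _ _ _ H1), <- (is_derive_unique _ _ _ H2); reflexivity. }
  (* On the slice, [w * E * f] minus the rescaled [g] is the affine function
     [c1 * x = c1 * x0 + c1 * (x - x0)], whose fifth derivative is 0. *)
  assert (E5 : w t0 * E * f5 = (/ w t0) ^ 5 * g5).
  { pose proof (smooth2_slice f t0 x0 Hf) as Sf.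
    pose proof (smooth2_slice g t1 x1 Hg) as Sg.
    unfold x1 in Sg; rewrite Rmult_comm in Sg.
    destruct (smooth1_near_scale _ _ _ Sg) as [Sg' Dg].
    destruct (smooth1_near_minus _ _ x0 (smooth1_near_scal _ (w t0 * E) x0 Sf) Sg') as [SD DD].
    specialize (DD 5%nat); rewrite Dg, Derive_n_scal_l in DD.
    rewrite (Rmult_comm (/ w t0) x0) in DD.
    change (Derive_n (fun y => w t0 * E * f t0 y - g t1 (/ w t0 * y)) 5 x0
      = w t0 * E * f5 - (/ w t0) ^ 5 * g5) in DD.
    apply Rminus_diag_uniq; rewrite <- DD.
    rewrite (taylor_unique _ 5 x0
      (fun k => List.nth k (c1 * x0 :: c1 :: 0 :: 0 :: 0 :: 0 :: nil) 0)); [simpl; ring|exact SD| |lia].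
    apply (limit1_in_ext_loc (fun _ => 0)); [|apply limit1_in_const].
    revert Lx; apply filter_imp; intros x L.
    rewrite (Rmult_comm (/ w t0) x); unfold t1; rewrite L; simpl; unfold E, Rdiv; ring. }
  unfold vc_kdv5, cc_kdv5; fold t1 x1 ft fx gt gx f5 g5; rewrite (hbeta t0 Ht), EN, G0.
  (* The factor [E^2 * w^3] is [U_u / T_t], the quotient of [w * E] by [/ E / w^2]. *)
  assert (V : (ft + f t0 x0 * fx + alpha t0 * f t0 x0 + / E * w t0 ^ 3 * f5) * (E ^ 2 * w t0 ^ 3)
    = gt + (w t0 * E * f t0 x0 - c1 * x0) * gx + 1 * g5).
  { assert (X1 : fx = (gx * / w t0 + c1) / (w t0 * E)) by (rewrite Ex; field; split; [lra|exact N]).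
    assert (X2 : ft = (gt * (/ E / w t0 ^ 2) + gx * (- (x0 * (c1 * / E)) / w t0 ^ 2)
      - (c1 * / E * E + w t0 * (alpha t0 * E)) * f t0 x0) / (w t0 * E))
      by (rewrite Et; field; split; [lra|exact N]).
    assert (X3 : f5 = (/ w t0) ^ 5 * g5 / (w t0 * E))
      by (rewrite <- E5; field; split; [lra|exact N]).
    rewrite X1, X2, X3; field; split; [exact N|lra]. }
  rewrite <- V; split; intros Z.
  - rewrite Z; ring.
  - destruct (Rmult_integral _ _ Z) as [Z'|Z']; [exact Z'|exfalso].
    revert Z'; apply Rmult_integral_contrapositive_currified; apply pow_nonzero; [lra|exact N].
Qed.

Lemma reducible_sufficient : reducible a b alpha beta.
Proof.
  exists 1, Om, (fun t _ _ => new_time t), (fun t x _ => x * / w t),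
    (fun t x u => w t * exp (A t) * u - c1 * x).
  split; [lra|split; [|split; [|split]]].
  - intros t x u K; exact K.
  - intros t Ht; now exists 0, 0.
  - exact normal_form_point_transformation.
  - exact normal_form_maps_equation.
Qed.

End Normal_form.

Theorem theorem2 (a b : Rbar) (alpha beta A B : R -> R)
  (hab : Rbar_lt a b)
  (halpha : smooth_on_itv a b alpha)
  (hbeta : smooth_on_itv a b beta)
  (hbeta0 : forall t, in_itv a b t -> beta t <> 0)
  (hA : forall t, in_itv a b t -> is_derive A t (alpha t))
  (hB : forall t, in_itv a b t -> is_derive B t (exp (- A t))) :
  reducible a b alpha beta <->
  exists c1 c2 : R,
    (c1, c2) <> (0, 0) /\
    forall t, in_itv a b t -> beta t = exp (- A t) * (c1 * B t + c2) ^ 3.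
Proof.
  split.
  - now apply reducible_necessary.
  - intros (c1 & c2 & _ & Hc).
    apply (reducible_sufficient a b alpha beta A B c1 c2); auto.
    (* A zero of [c1 * B + c2] would be a zero of [beta]. *)
    intros t Ht Z; apply (hbeta0 t Ht); rewrite (Hc t Ht), Z; ring.
Qed.
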